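(* Let $(\mathcal{C},\phi,\Delta)$ be a categorical Garside structure and let $m\ge1$ be an integer. Then the triple $(\mathcal{C}_m,\phi_m,\Delta_m)$, where $\mathcal{C}_m$ is the $m$-divided category of $(\mathcal{C},\phi,\Delta)$, is a categorical Garside structure.
   Context: Conventions. Morphisms compose like paths: $x\xrightarrow{f}y\xrightarrow{g}z$ has composite $fg$. The image of an object or morphism under an automorphism $\phi$ is written $x^\phi$, $f^\phi$. In a category $\mathcal{C}$, $\mathcal{C}_{x\to}$ (resp. $\mathcal{C}_{\to x}$) is the set of morphisms with source (resp. target) $x$; $f\le g$ on $\mathcal{C}_{x\to}$ means $g=fh$ for some $h$; $g\ge h$ on $\mathcal{C}_{\to x}$ means $g=fh$ for some $f$. An atom is a non-identity morphism that is not a product of two non-identity morphisms. A categorical Garside structure is a triple $(\mathcal{C},\phi,\Delta)$ where $\mathcal{C}$ is a small category, $\phi$ is an automorphism of $\mathcal{C}$ and $\Delta$ is a natural transformation from the identity functor to $\phi$ (so $\Delta_x:x\to x^\phi$ and $f\Delta_y=\Delta_xf^\phi$ for $f:x\to y$), such that: $\mathcal{C}$ is homogeneous (there is a function $l$ from morphisms to $\mathbb{Z}_{\ge0}$ with $l(fg)=l(f)+l(g)$ and $l(f)=0$ iff $f$ is an identity); $\mathcal{C}$ is cancellative ($afb=agb$ implies $f=g$); every atom is simple, where $f:x\to y$ is simple if there is $\overline f:y\to x^\phi$ with $f\overline f=\Delta_x$; for every object $x$, $(\mathcal{C}_{x\to},\le)$ and $(\mathcal{C}_{\to x},\ge)$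 are lattices. Divided category. Let $D_m$ be the set of sequences $f=(f_1,\dots,f_m)$ of composable $\mathcal{C}$-morphisms with $f_1\cdots f_m=\Delta_{x_1}$, $x_1$ the source of $f_1$ (each $f_i$ is then simple). Indices of such sequences of objects or morphisms are extended beyond $m$ by $a_{m+i}:=a_i^\phi$. Let $S_m$ be the oriented graph with vertex set $D_m$ in which an edge $f\to g$ is a sequence $s=(s_1,\dots,s_m)$ of simple morphisms of $\mathcal{C}$, $s_i$ going from the source of $f_i$ to the source of $g_i$, for which there are factorisations $f_i=s_is'_i$ with $g_i=s'_is_{i+1}$ for $i=1,\dots,m$ (with $s_{m+1}=s_1^\phi$; the $s'_i$ are unique by cancellativity). For edges $s:f\to g$, $t:g\to h$, the partial product $st:=(s_1t_1,\dots,s_mt_m)$ is defined exactly when each $s_it_i$ is simple and $(s_1t_1,\dots,s_mt_m)$ is an edge $f\to h$ of $S_m$. The category $\mathcal{C}_m$ is the free category on this germ: objects are the elements of $D_m$, morphisms are generated by the edges of $S_m$, subject to the relations that the formal composite of $s$ and $t$ equals $st$ whenever the partial product is defined, and that the edge $(1,\dots,1):f\to f$ is the identity of $f$. The automorphism $\phi_m$ of $\mathcal{C}_m$ is given on objects by $(f_1,\dots,f_m)^{\phi_m}=(f_2,\dots,f_m,f_1^\phi)$ and on edges by $(s_1,\dots,s_m)^{\phi_m}=(s_2,\dots,s_m,s_1^\phi)$. The natural transformation $\Delta_m$ from the identity to $\phi_m$ sends $f=(f_1,\dots,f_m)$ to the edge $\Delta_{m,f}:=(f_1,\dots,f_m):f\to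 f^{\phi_m}$ of $S_m$ (with all $s'_i$ identities). *)

(* Defs.v *)
From HB Require Import structures.
From Stdlib Require Import Relation_Operators.
From mathcomp Require Import all_boot.
From mathcomp Require Import boolp.

Set Implicit Arguments.
Unset Strict Implicit.
Unset Printing Implicit Defensive.

(* Composition is written in path order.  It is a total function whose value
   is meaningful only on composable pairs [tgt f = src g]: no axiom constrains
   it elsewhere, and every later definition guards it by composability. *)
Record category := Category {
  ob : Type;
  mor : Type;
  src : mor -> ob;
  tgt : mor -> ob;
  idm : ob -> mor;
  mcomp : mor -> mor -> mor;
  src_idm : forall x, src (idm x) = x;
  tgt_idm : forall x, tgt (idm x) = x;
  src_mcomp : forall f g, tgt f = src g -> src (mcomp f g) = src f;
  tgt_mcomp : forall f g, tgt f = src g -> tgt (mcomp f g) = tgt g;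
  mcomp1l : forall f, mcomp (idm (src f)) f = f;
  mcomp1r : forall f, mcomp f (idm (tgt f)) = f;
  mcompA : forall f g h, tgt f = src g -> tgt g = src h ->
    mcomp f (mcomp g h) = mcomp (mcomp f g) h
}.

Notation "f ;; g" := (mcomp f g) (at level 40, left associativity).

Record functor (C D : category) := Functor {
  fob : ob C -> ob D;
  fmor : mor C -> mor D;
  src_fmor : forall f, src (fmor f) = fob (src f);
  tgt_fmor : forall f, tgt (fmor f) = fob (tgt f);
  fmor_idm : forall x, fmor (idm x) = idm (fob x);
  fmor_comp : forall f g, tgt f = src g -> fmor (f ;; g) = fmor f ;; fmor g
}.

Definition is_automorphism (C : category) (phi : functor C C) : Prop :=
  bijective (fob phi) /\ bijective (fmor phi).

Definition is_natural_from_id (C : category) (phi : functor C C)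
    (Delta : ob C -> mor C) : Prop :=
  [/\ forall x, src (Delta x) = x,
      forall x, tgt (Delta x) = fob phi x
    & forall f, f ;; Delta (tgt f) = Delta (src f) ;; fmor phi f].

Section GarsideNotions.
Variable C : category.

Definition is_id (f : mor C) : Prop := f = idm (src f).

Definition is_atom (f : mor C) : Prop :=
  ~ is_id f /\
  ~ (exists g h, [/\ tgt g = src h, ~ is_id g, ~ is_id h & f = g ;; h]).

Definition homogeneous : Prop :=
  exists l : mor C -> nat,
    (forall f g, tgt f = src g -> l (f ;; g) = l f + l g) /\
    (forall f, l f = 0 <-> is_id f).

Definition cancellative : Prop :=
  forall a f g b : mor C,
    tgt a = src f -> tgt a = src g -> tgt f = src b -> tgt g = src b ->
    a ;; f ;; b = a ;; g ;; b -> f = g.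

Definition is_simple (phi : functor C C) (Delta : ob C -> mor C)
    (f : mor C) : Prop :=
  exists f', [/\ tgt f = src f', tgt f' = fob phi (src f)
               & f ;; f' = Delta (src f)].

Definition left_div (f g : mor C) : Prop :=
  exists h, tgt f = src h /\ g = f ;; h.

Definition right_div (h g : mor C) : Prop :=
  exists f, tgt f = src h /\ g = f ;; h.

End GarsideNotions.

Record is_lattice (T : Type) (P : T -> Prop) (le : T -> T -> Prop) : Prop := {
  lat_refl : forall a, P a -> le a a;
  lat_trans : forall a b c, P a -> P b -> P c -> le a b -> le b c -> le a c;
  lat_anti : forall a b, P a -> P b -> le a b -> le b a -> a = b;
  lat_join : forall a b, P a -> P b ->
    exists j, [/\ P j, le a j, le b j
                & forall c, P c -> le a c -> le b c -> le j c];
  lat_meet : forall a b, P a -> P b ->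
    exists k, [/\ P k, le k a, le k b
                & forall c, P c -> le c a -> le c b -> le c k]
}.

Record is_garside (C : category) (phi : functor C C) (Delta : ob C -> mor C)
  : Prop := {
  gar_phi : is_automorphism phi;
  gar_Delta : is_natural_from_id phi Delta;
  gar_homogeneous : homogeneous C;
  gar_cancellative : cancellative C;
  gar_atom_simple : forall f : mor C, is_atom f -> is_simple phi Delta f;
  gar_lattice_src : forall x : ob C,
    is_lattice (fun f => src f = x) (@left_div C);
  gar_lattice_tgt : forall x : ob C,
    is_lattice (fun f => tgt f = x) (@right_div C)
}.

(* [es] is a sequence of composable arrows, the first of which starts at
   [x]. *)
Fixpoint chain (V E : Type) (s t : E -> V) (x : V) (es : seq E) : Prop :=
  if es is e :: es' then s e = x /\ chain s t (t e) es' else True.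

Lemma chain_cat (V E : Type) (s t : E -> V) x (es es' : seq E) :
  chain s t x (es ++ es') <->
  chain s t x es /\ chain s t (last x (map t es)) es'.
Proof.
elim: es x => [|e es IH] x /=; first by split=> // -[].
by rewrite IH; split=> [[-> [? ?]]|[[-> ?] ?]].
Qed.

(* An oriented graph with unit edges and a partial product of edges;
   [gprod s t u] means that the product of [s] and [t] is defined and equal
   to [u].  Only what is needed to form the free category is recorded. *)
Record germ := Germ {
  gvert : Type;
  gedge : Type;
  gsrc : gedge -> gvert;
  gtgt : gedge -> gvert;
  gone : gvert -> gedge;
  gprod : gedge -> gedge -> gedge -> Prop;
  gsrc_one : forall x, gsrc (gone x) = x;
  gtgt_one : forall x, gtgt (gone x) = x;
  gprod_typed : forall s t u, gprod s t u ->
    [/\ gtgt s = gsrc t, gsrc u = gsrc s & gtgt u = gtgt t]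
}.

Arguments gone : clear implicits.

Section FreeCategory.
Variable G : germ.

Record walk := Walk {
  wsrc : gvert G;
  wedges : seq (gedge G);
  wedgesP : chain (@gsrc G) (@gtgt G) wsrc wedges
}.

HB.instance Definition _ := gen_eqMixin walk.
HB.instance Definition _ := gen_choiceMixin walk.

Definition wtgt (p : walk) : gvert G := last (wsrc p) (map (@gtgt G) (wedges p)).

Lemma walk_inj (p q : walk) : wsrc p = wsrc q -> wedges p = wedges q -> p = q.
Proof.
case: p q => [x es H] [y es' H'] /= exy ees; subst.
by congr Walk; apply: Prop_irrelevance.
Qed.

Inductive word_step : seq (gedge G) -> seq (gedge G) -> Prop :=
| step_prod l s t u r : gprod s t u ->
    word_step (l ++ [:: s; t] ++ r) (l ++ [:: u] ++ r)
| step_one l x r :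
    word_step (l ++ [:: gone G x] ++ r) (l ++ r).

Definition walk_step (p q : walk) : Prop :=
  wsrc p = wsrc q /\ word_step (wedges p) (wedges q).

(* Rewriting takes place inside well-formed walks, so this closure is the
   congruence for concatenation generated by the relations of the germ. *)
Definition walk_eq : walk -> walk -> Prop :=
  clos_refl_sym_trans walk walk_step.

Definition walk_eqb (p q : walk) : bool := `[< walk_eq p q >].

Lemma walk_eqb_refl : reflexive walk_eqb.
Proof. by move=> p; apply/asboolP; apply: rst_refl. Qed.

Lemma walk_eqb_sym : symmetric walk_eqb.
Proof.
by move=> p q; apply/asboolP/asboolP => H; apply: rst_sym.
Qed.

Lemma walk_eqb_trans : transitive walk_eqb.
Proof.
by move=> q p r /asboolP H /asboolP H'; apply/asboolP; apply: rst_trans H H'.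
Qed.

Canonical walk_equiv := EquivRel walk_eqb walk_eqb_refl walk_eqb_sym walk_eqb_trans.

Definition free_mor : Type := {eq_quot walk_equiv}%qT.

Definition class (p : walk) : free_mor := (\pi_free_mor p)%qT.

Lemma classP p q : class p = class q <-> walk_eq p q.
Proof.
split=> [/eqquotP /= /asboolP //|H].
by apply/eqquotP; apply/asboolP.
Qed.

Definition rep (c : free_mor) : walk := repr c.

Lemma repK c : class (rep c) = c.
Proof. exact: reprK. Qed.

Lemma rep_class p : walk_eq (rep (class p)) p.
Proof. by apply/classP; rewrite repK. Qed.

Lemma walk_step_ends p q :
  walk_step p q -> wsrc p = wsrc q /\ wtgt p = wtgt q.
Proof.
case: p q => [x es H] [y es' H'] [/= exy st]; subst y; split=> //.
rewrite /wtgt /=; case: st H {H'} => [l s t u r pr|l z r] H.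
  by rewrite !map_cat !last_cat /=; case: (gprod_typed pr) => _ _ ->.
move/chain_cat: H => [_ /= [e _]].
by rewrite !map_cat !last_cat /= gtgt_one -e gsrc_one.
Qed.

Lemma walk_eq_ends p q : walk_eq p q -> wsrc p = wsrc q /\ wtgt p = wtgt q.
Proof.
elim=> [{}p {}q /walk_step_ends //|//|{}p {}q _ [-> ->] //|].
by move=> {}p r {}q _ [-> ->] _ [-> ->].
Qed.

Definition wnil (x : gvert G) : walk := @Walk x [::] I.

Definition wedge1 (e : gedge G) : walk :=
  @Walk (gsrc e) [:: e] (conj erefl I).

Lemma wcat_subproof p q : wtgt p = wsrc q ->
  chain (@gsrc G) (@gtgt G) (wsrc p) (wedges p ++ wedges q).
Proof.
move=> e; apply/chain_cat; split; first exact: wedgesP.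
by rewrite -[last _ _]/(wtgt p) e; exact: wedgesP.
Qed.

(* Concatenation; the default value [p] is used on non-composable walks. *)
Definition wcat (p q : walk) : walk :=
  if pselect (wtgt p = wsrc q) is left e then Walk (wcat_subproof e) else p.

Lemma wsrc_cat p q : wsrc (wcat p q) = wsrc p.
Proof. by rewrite /wcat; case: pselect. Qed.

Lemma wedges_cat p q : wtgt p = wsrc q ->
  wedges (wcat p q) = wedges p ++ wedges q.
Proof. by rewrite /wcat; case: pselect. Qed.

Lemma wtgt_cat p q : wtgt p = wsrc q -> wtgt (wcat p q) = wtgt q.
Proof.
move=> e; rewrite /wtgt wsrc_cat wedges_cat // map_cat last_cat.
by rewrite -[last (wsrc p) _]/(wtgt p) e.
Qed.

Lemma word_step_cat l r es es' :
  word_step es es' -> word_step (l ++ es ++ r) (l ++ es' ++ r).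
Proof.
case=> [l' s t u r' pr|l' x r'].
  have := step_prod (l ++ l') (r' ++ r) pr.
  by rewrite -!catA.
have := step_one (l ++ l') x (r' ++ r).
by rewrite -!catA.
Qed.

Lemma wcat_eql p p' q : wtgt p = wsrc q -> walk_eq p p' ->
  walk_eq (wcat p q) (wcat p' q).
Proof.
move=> e H; elim: H e => {p p'}.
- move=> p p' st e; have [es et] := walk_step_ends st.
  apply: rst_step; split; first by rewrite !wsrc_cat.
  rewrite !wedges_cat -?et //.
  exact: (word_step_cat [::] (wedges q) st.2).
- by move=> p e; apply: rst_refl.
- move=> p p' H IH e; apply: rst_sym; apply: IH.
  by rewrite (walk_eq_ends H).2.
- move=> p r p' H IH H' IH' e; apply: rst_trans (IH e) (IH' _).
  by rewrite -(walk_eq_ends H).2.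
Qed.

Lemma wcat_eqr p q q' : wtgt p = wsrc q -> walk_eq q q' ->
  walk_eq (wcat p q) (wcat p q').
Proof.
move=> e H; elim: H e => {q q'}.
- move=> q q' st e; have [es et] := walk_step_ends st.
  apply: rst_step; split; first by rewrite !wsrc_cat.
  rewrite !wedges_cat -?es //.
  by have := word_step_cat (wedges p) [::] st.2; rewrite !cats0.
- by move=> q e; apply: rst_refl.
- move=> q q' H IH e; apply: rst_sym; apply: IH.
  by rewrite (walk_eq_ends H).1.
- move=> q r q' H IH H' IH' e; apply: rst_trans (IH e) (IH' _).
  by rewrite -(walk_eq_ends H).1.
Qed.

Definition free_src (c : free_mor) : gvert G := wsrc (rep c).
Definition free_tgt (c : free_mor) : gvert G := wtgt (rep c).
Definition free_id (x : gvert G) : free_mor := class (wnil x).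
Definition free_comp (c d : free_mor) : free_mor := class (wcat (rep c) (rep d)).

Lemma free_src_class p : free_src (class p) = wsrc p.
Proof. exact: (walk_eq_ends (rep_class p)).1. Qed.

Lemma free_tgt_class p : free_tgt (class p) = wtgt p.
Proof. exact: (walk_eq_ends (rep_class p)).2. Qed.

Lemma free_comp_class p q : wtgt p = wsrc q ->
  free_comp (class p) (class q) = class (wcat p q).
Proof.
move=> e; apply/classP.
have [es et] := walk_eq_ends (rep_class p).
have [es' et'] := walk_eq_ends (rep_class q).
apply: (@rst_trans _ _ _ (wcat p (rep (class q)))).
  by apply: wcat_eql (rep_class p); rewrite et es'.
by apply: wcat_eqr (rep_class q); rewrite es'.
Qed.

Lemma free_src_id x : free_src (free_id x) = x.
Proof. by rewrite free_src_class. Qed.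

Lemma free_tgt_id x : free_tgt (free_id x) = x.
Proof. by rewrite free_tgt_class. Qed.

Lemma free_src_comp c d : free_tgt c = free_src d ->
  free_src (free_comp c d) = free_src c.
Proof. by move=> e; rewrite free_src_class wsrc_cat. Qed.

Lemma free_tgt_comp c d : free_tgt c = free_src d ->
  free_tgt (free_comp c d) = free_tgt d.
Proof. by move=> e; rewrite free_tgt_class wtgt_cat. Qed.

Lemma free_comp1l c : free_comp (free_id (free_src c)) c = c.
Proof.
rewrite -[in RHS](repK c) -{2}(repK c) free_comp_class //; congr class.
by apply: walk_inj; rewrite ?wsrc_cat ?wedges_cat.
Qed.

Lemma free_comp1r c : free_comp c (free_id (free_tgt c)) = c.
Proof.
rewrite -[in RHS](repK c) -{1}(repK c) free_comp_class //; congr class.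
by apply: walk_inj; rewrite ?wsrc_cat ?wedges_cat //= cats0.
Qed.

Lemma free_compA c d e : free_tgt c = free_src d -> free_tgt d = free_src e ->
  free_comp c (free_comp d e) = free_comp (free_comp c d) e.
Proof.
move=> cd de; rewrite -(repK c) -(repK d) -(repK e).
rewrite (@free_comp_class (rep c) (rep d)) //.
rewrite (@free_comp_class (rep d) (rep e)) //.
rewrite !free_comp_class ?wsrc_cat ?wtgt_cat //; congr class.
by apply: walk_inj; rewrite ?wsrc_cat // !wedges_cat ?wsrc_cat ?wtgt_cat // catA.
Qed.

Definition free_category : category :=
  @Category (gvert G) free_mor free_src free_tgt free_id free_comp
    free_src_id free_tgt_id free_src_comp free_tgt_comp
    free_comp1l free_comp1r free_compA.

Definition free_edge (e : gedge G) : mor free_category := class (wedge1 e).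

End FreeCategory.

Section FreeFunctor.
Variables (G H : germ) (v : gvert G -> gvert H) (e : gedge G -> gedge H).
Hypothesis e_src : forall s, gsrc (e s) = v (gsrc s).
Hypothesis e_tgt : forall s, gtgt (e s) = v (gtgt s).
Hypothesis e_one : forall x, e (gone G x) = gone H (v x).
Hypothesis e_prod : forall s t u, gprod s t u -> gprod (e s) (e t) (e u).

Lemma wmap_subproof (p : walk G) :
  chain (@gsrc H) (@gtgt H) (v (wsrc p)) (map e (wedges p)).
Proof.
case: p => x es /=; elim: es x => [|s es IH] x //= [<- ?].
by rewrite e_src e_tgt; split=> //; apply: IH.
Qed.

Definition wmap (p : walk G) : walk H := Walk (wmap_subproof p).

Lemma wtgt_map p : wtgt (wmap p) = v (wtgt p).
Proof.
case: p => x es chn; rewrite /wtgt /= -map_comp {chn}.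
by elim: es x => //= s es IH x; rewrite e_tgt IH.
Qed.

Lemma wmap_eq p q : walk_eq p q -> walk_eq (wmap p) (wmap q).
Proof.
elim=> [{}p {}q [es st]|{}p|{}p {}q _|{}p r {}q _ IH _]; last 1 first.
- exact: rst_trans.
- apply: rst_step; split; first by rewrite /= es.
  rewrite /=; case: st => [l s t u r pr|l x r]; rewrite !map_cat /=.
    exact/step_prod/e_prod.
  by rewrite e_one; apply: step_one.
- exact: rst_refl.
- exact: rst_sym.
Qed.

Definition free_map_mor (c : mor (free_category G)) : mor (free_category H) :=
  class (wmap (rep c)).

Lemma free_map_class p : free_map_mor (class p) = class (wmap p).
Proof. exact/classP/wmap_eq/rep_class. Qed.

Lemma free_map_src c : src (free_map_mor c) = v (src c).
Proof. exact: free_src_class. Qed.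

Lemma free_map_tgt c : tgt (free_map_mor c) = v (tgt c).
Proof. by rewrite /= free_tgt_class wtgt_map. Qed.

Lemma free_map_id x :
  free_map_mor (idm x) = @idm (free_category H) (v x).
Proof.
rewrite /= free_map_class; congr class.
exact: walk_inj.
Qed.

Lemma free_map_comp (c d : mor (free_category G)) : tgt c = src d ->
  free_map_mor (c ;; d) = free_map_mor c ;; free_map_mor d.
Proof.
move=> cd; rewrite /= free_map_class free_comp_class; last first.
  by rewrite wtgt_map; congr v.
congr class; apply: walk_inj; first by rewrite /= !wsrc_cat.
rewrite /= !wedges_cat ?map_cat // wtgt_map.
by congr v.
Qed.

Definition free_functor : functor (free_category G) (free_category H) :=
  Functor free_map_src free_map_tgt free_map_id free_map_comp.

Lemma free_functor_edge s : fmor free_functor (free_edge s) = free_edge (e s).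
Proof.
rewrite /= free_map_class; congr class.
by apply: walk_inj; rewrite //= e_src.
Qed.

End FreeFunctor.

Section Extension.
Variables (T : Type) (phi : T -> T) (m : nat) (hm : 0 < m).

(* Indices start at 0, so [ext a k] is the term of index [k + 1] in the
   1-based convention. *)
Definition ext (a : m.-tuple T) (k : nat) : T :=
  iter (k %/ m) phi (tnth a (Ordinal (ltn_pmod k hm))).

Definition shift (a : m.-tuple T) : m.-tuple T := [tuple ext a i.+1 | i < m].

Lemma ext_ord (a : m.-tuple T) (i : 'I_m) : ext a i = tnth a i.
Proof.
rewrite /ext divn_small //=; congr (tnth a _); apply: val_inj => /=.
by rewrite modn_small.
Qed.

Lemma ext_add a k : ext a (m + k) = phi (ext a k).
Proof.
rewrite /ext -{1}[m]mul1n divnMDl // add1n iterS; congr (phi (iter _ _ (tnth a _))).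
by apply: val_inj; rewrite /= modnDl.
Qed.

Lemma ext_mul a q k : ext a (q * m + k) = iter q phi (ext a k).
Proof.
elim: q => [|q IH]; first by rewrite mul0n.
by rewrite mulSn -addnA ext_add IH.
Qed.

Lemma ext_shift a k : ext (shift a) k = ext a k.+1.
Proof.
rewrite {1}/ext tnth_mktuple /= -ext_mul; congr (ext a _).
by rewrite addnS -divn_eq.
Qed.

Lemma ext_iter_shift a k j : ext (iter k shift a) j = ext a (k + j).
Proof. by elim: k j => // k IH j; rewrite iterS ext_shift IH addSnnS. Qed.

Lemma ext_inj a b : (forall i : 'I_m, ext a i = ext b i) -> a = b.
Proof. by move=> H; apply: eq_from_tnth => i; rewrite -!ext_ord. Qed.

End Extension.

Section CompositeOfSequence.
Variable C : category.

Fixpoint composite (x : ob C) (fs : seq (mor C)) : mor C :=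
  if fs is f :: fs' then f ;; composite (tgt f) fs' else idm x.

Notation cchain := (chain (@src C) (@tgt C)).

Lemma composite_ends x fs : cchain x fs ->
  src (composite x fs) = x /\
  tgt (composite x fs) = last x (map (@tgt C) fs).
Proof.
elim: fs x => [|f fs IH] x /=; first by rewrite src_idm tgt_idm.
by move=> [<- /IH [es et]]; rewrite src_mcomp ?tgt_mcomp ?es.
Qed.

Lemma composite_rcons x fs f : cchain x (rcons fs f) ->
  composite x (rcons fs f) = composite x fs ;; f.
Proof.
elim: fs x => [|g fs IH] x /=.
  by move=> [<- _]; rewrite mcomp1r mcomp1l.
move=> [_ H]; rewrite IH //.
move: H; rewrite -cats1 => /chain_cat [H /= [ef _]].
by rewrite mcompA // ?(composite_ends H).1 ?(composite_ends H).2.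
Qed.

End CompositeOfSequence.

Section Divided.
Variables (C : category) (phi : functor C C) (Delta : ob C -> mor C).
Variables (m : nat) (hm : 0 < m).

Local Notation cchain := (chain (@src C) (@tgt C)).
Local Notation mext := (ext (fmor phi) hm).
Local Notation mshift := (shift (fmor phi) hm).

Definition in_D (f : m.-tuple (mor C)) : Prop :=
  let x1 := src (tnth f (Ordinal hm)) in
  cchain x1 f /\ composite x1 f = Delta x1.

Definition D : Type := {f : m.-tuple (mor C) | in_D f}.

Definition Dseq (f : D) : m.-tuple (mor C) := sval f.

Lemma D_inj (f g : D) : Dseq f = Dseq g -> f = g.
Proof.
by case: f g => [f Hf] [g Hg] /= e; apply: eq_exist.
Qed.

(* [tnth s i] is [s_(i+1)] in the 1-based convention; the following term
   [mext s i.+1] equals [phi s_1] when [i] is the last index. *)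
Definition is_edge (f g s : m.-tuple (mor C)) : Prop :=
  (forall i, [/\ is_simple phi Delta (tnth s i),
                 src (tnth s i) = src (tnth f i)
               & tgt (tnth s i) = src (tnth g i)]) /\
  (exists s' : m.-tuple (mor C), forall i : 'I_m,
     [/\ tgt (tnth s i) = src (tnth s' i),
         tnth f i = tnth s i ;; tnth s' i,
         tgt (tnth s' i) = src (mext s i.+1)
       & tnth g i = tnth s' i ;; mext s i.+1]).

Record sedge := SEdge {
  sesrc : D;
  setgt : D;
  seseq : m.-tuple (mor C);
  seP : is_edge (Dseq sesrc) (Dseq setgt) seseq
}.

Lemma sedge_inj (s t : sedge) : sesrc s = sesrc t -> setgt s = setgt t ->
  seseq s = seseq t -> s = t.
Proof.
case: s t => [f g s Hs] [f' g' t Ht] /= e1 e2 e3; subst.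
by congr SEdge; apply: Prop_irrelevance.
Qed.

(* That the componentwise products are simple and form an edge is part of
   [u] being an edge. *)
Definition sprod (s t u : sedge) : Prop :=
  [/\ setgt s = sesrc t, sesrc u = sesrc s, setgt u = setgt t
    & forall i, tnth (seseq u) i = tnth (seseq s) i ;; tnth (seseq t) i].

Hypothesis gar : is_garside phi Delta.

Lemma src_Delta x : src (Delta x) = x.
Proof. by case: (gar_Delta gar). Qed.

Lemma tgt_Delta x : tgt (Delta x) = fob phi x.
Proof. by case: (gar_Delta gar). Qed.

Lemma natural_Delta f : f ;; Delta (tgt f) = Delta (src f) ;; fmor phi f.
Proof. by case: (gar_Delta gar). Qed.

Lemma mcompIl (a f g : mor C) : tgt a = src f -> tgt a = src g -> tgt f = tgt g ->
  a ;; f = a ;; g -> f = g.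
Proof.
move=> af ag fg e.
apply: (@gar_cancellative _ _ _ gar a f g (idm (tgt f))) => //.
- by rewrite src_idm.
- by rewrite src_idm fg.
- by rewrite e.
Qed.

Lemma phi_Delta x : fmor phi (Delta x) = Delta (fob phi x).
Proof.
apply: (@mcompIl (Delta x)).
- by rewrite src_fmor tgt_Delta src_Delta.
- by rewrite src_Delta tgt_Delta.
- by rewrite tgt_fmor !tgt_Delta.
- by have := natural_Delta (Delta x); rewrite tgt_Delta src_Delta => ->.
Qed.

Lemma simple_phi f : is_simple phi Delta f -> is_simple phi Delta (fmor phi f).
Proof.
move=> [f' [e1 e2 e3]]; exists (fmor phi f').
by rewrite !src_fmor !tgt_fmor e1 e2 -fmor_comp // e3 phi_Delta.
Qed.

Lemma simple_idm x : is_simple phi Delta (idm x).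
Proof.
exists (Delta x); rewrite tgt_idm src_idm src_Delta tgt_Delta.
by split=> //; rewrite -{1}(src_Delta x) mcomp1l.
Qed.

Lemma in_D_shift_aux (f : m.-tuple (mor C)) : in_D f ->
  [/\ in_D (mshift f), tgt (mext f 0) = src (mext f 1)
    & is_simple phi Delta (mext f 0)].
Proof.
have e0 a : tnth a (Ordinal hm) = mext a 0.
  by rewrite -(ext_ord (fmor phi) hm a (Ordinal hm)).
rewrite /in_D !e0 ext_shift.
have vf : val f = mext f 0 :: behead f.
  rewrite -e0 (tnth_nth (mext f 0)) /=; move: (mext f 0) => d.
  by have := hm; rewrite -{1}(size_tuple f); case: (tval f).
have vs : val (mshift f) = rcons (behead f) (fmor phi (mext f 0)).
  apply: (@eq_from_nth _ (mext f 0)).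
    by rewrite size_rcons size_behead !size_tuple prednK.
  move=> i; rewrite size_tuple => im.
  rewrite -(tnth_nth _ _ (Ordinal im)) tnth_mktuple /=.
  rewrite nth_rcons size_behead size_tuple nth_behead.
  case: (ltngtP i m.-1) => im1.
  - have im2 : i.+1 < m by rewrite -ltn_predRL.
    by rewrite -[i.+1]/(val (Ordinal im2)) ext_ord (tnth_nth (mext f 0)).
  - by rewrite -(prednK hm) ltnS leqNgt im1 in im.
  - by rewrite im1 prednK // -[X in mext f X]addn0 ext_add.
rewrite -[tval f]/(val f) -[tval (mshift f)]/(val (mshift f)) vs vf /=.
set x := src (mext f 0); set a := mext f 0 => -[[_ chn] cmp].
have [bs bt] := composite_ends chn.
have tb : tgt (composite (tgt a) (behead f)) = fob phi x.
  by rewrite -tgt_Delta -cmp tgt_mcomp // bs.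
have chn' : cchain (tgt a) (rcons (behead f) (fmor phi a)).
  rewrite -cats1; apply/chain_cat; split=> //=; split=> //.
  by rewrite src_fmor -bt tb.
have s1 : tgt a = src (mext f 1).
  rewrite -ext_shift -e0 (tnth_nth a) /= -[tval _]/(val (mshift f)) vs.
  by case: (rcons _ _) (size_rcons (behead f) (fmor phi a)) chn' => // b l _ [].
rewrite -s1; split=> //; last first.
  by exists (composite (tgt a) (behead f)); rewrite bs.
split=> //; rewrite composite_rcons //.
have sp : src (fmor phi a) = fob phi x by rewrite src_fmor.
apply: (@mcompIl a).
- by rewrite src_mcomp ?bs // tb sp.
- by rewrite src_Delta.
- by rewrite tgt_mcomp ?tb ?sp // tgt_fmor tgt_Delta.
- by rewrite mcompA ?bs ?tb ?sp // cmp natural_Delta.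
Qed.

Lemma in_D_iter_shift f k : in_D f -> in_D (iter k mshift f).
Proof. by move=> Hf; elim: k => // k /in_D_shift_aux []. Qed.

Lemma D_tgt (f : D) k : tgt (mext (Dseq f) k) = src (mext (Dseq f) k.+1).
Proof.
have [_ + _] := in_D_shift_aux (in_D_iter_shift k (svalP f)).
by rewrite !ext_iter_shift addn0 addn1.
Qed.

Lemma D_simple (f : D) k : is_simple phi Delta (mext (Dseq f) k).
Proof.
have [_ _] := in_D_shift_aux (in_D_iter_shift k (svalP f)).
by rewrite ext_iter_shift addn0.
Qed.

Lemma in_D_shift f : in_D f -> in_D (mshift f).
Proof. by case/in_D_shift_aux. Qed.

Definition Dshift (f : D) : D := exist _ (mshift (Dseq f)) (in_D_shift (svalP f)).

Lemma is_edge_shift f g s :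
  is_edge f g s -> is_edge (mshift f) (mshift g) (mshift s).
Proof.
move=> [H [s' H']].
have ext_ind (P : nat -> Prop) : (forall i : 'I_m, P i) ->
    (forall k, P k -> P (m + k)) -> forall k, P k.
  move=> P0 PS k; rewrite (divn_eq k m); elim: (k %/ m) => [|q IH].
    by rewrite mul0n; exact: (P0 (Ordinal (ltn_pmod k hm))).
  by rewrite mulSn -addnA; apply: PS.
have K k : [/\ is_simple phi Delta (mext s k),
    src (mext s k) = src (mext f k) & tgt (mext s k) = src (mext g k)].
  elim/ext_ind: k => [i|k [k1 k2 k3]]; first by rewrite !ext_ord.
  rewrite !ext_add !src_fmor !tgt_fmor k2 k3; split=> //.
  exact: simple_phi.
have K' k : [/\ tgt (mext s k) = src (mext s' k),
    mext f k = mext s k ;; mext s' k,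
    tgt (mext s' k) = src (mext s k.+1) &
    mext g k = mext s' k ;; mext s k.+1].
  elim/ext_ind: k => [i|k [k1 k2 k3 k4]]; first by rewrite !ext_ord.
  rewrite -addnS !ext_add !src_fmor !tgt_fmor k1 k3; split=> //.
    by rewrite k2 fmor_comp.
  by rewrite k4 fmor_comp.
split=> [i|]; first by rewrite !tnth_mktuple.
by exists (mshift s') => i; rewrite !tnth_mktuple ext_shift.
Qed.

Definition sshift (s : sedge) : sedge :=
  @SEdge (Dshift (sesrc s)) (Dshift (setgt s)) (mshift (seseq s))
    (is_edge_shift (seP s)).

Definition one_seq (f : D) : m.-tuple (mor C) :=
  [tuple idm (src (tnth (Dseq f) i)) | i < m].

Lemma ext_one_seq f k : mext (one_seq f) k = idm (src (mext (Dseq f) k)).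
Proof.
rewrite /ext tnth_mktuple; elim: (k %/ m) => //= q ->.
by rewrite fmor_idm src_fmor.
Qed.

Lemma is_edge_one f : is_edge (Dseq f) (Dseq f) (one_seq f).
Proof.
split=> [i|].
  by rewrite tnth_mktuple src_idm tgt_idm; split=> //; apply: simple_idm.
exists (Dseq f) => i.
rewrite tnth_mktuple ext_one_seq src_idm tgt_idm mcomp1l.
have := D_tgt f i; rewrite ext_ord => e; rewrite -e mcomp1r.
by split.
Qed.

Definition sone (f : D) : sedge := SEdge (is_edge_one f).

Lemma is_edge_Delta f : is_edge (Dseq f) (Dseq (Dshift f)) (Dseq f).
Proof.
split=> [i|].
  rewrite tnth_mktuple -D_tgt ext_ord; split=> //.
  by rewrite -(ext_ord (fmor phi) hm); apply: D_simple.
exists [tuple idm (tgt (tnth (Dseq f) i)) | i < m] => i.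
rewrite !tnth_mktuple src_idm tgt_idm mcomp1r -D_tgt ext_ord.
by split=> //; rewrite -[in RHS](ext_ord (fmor phi) hm) D_tgt mcomp1l.
Qed.

Definition sDelta (f : D) : sedge := SEdge (is_edge_Delta f).

Lemma sprod_typed s t u : sprod s t u ->
  [/\ setgt s = sesrc t, sesrc u = sesrc s & setgt u = setgt t].
Proof. by case. Qed.

Definition divided_germ : germ :=
  @Germ D sedge sesrc setgt sone sprod
    (fun _ => erefl) (fun _ => erefl) sprod_typed.

Definition divided_category : category := free_category divided_germ.

Lemma sshift_one f : sshift (sone f) = sone (Dshift f).
Proof.
apply: sedge_inj => //=; apply: eq_from_tnth => i.
by rewrite !tnth_mktuple ext_one_seq.
Qed.

Lemma sshift_prod s t u : sprod s t u ->
  sprod (sshift s) (sshift t) (sshift u).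
Proof.
move=> [e1 e2 e3 H]; split; rewrite /= ?e1 ?e2 ?e3 // => i.
rewrite !tnth_mktuple /ext H.
set j := Ordinal _.
have : tgt (tnth (seseq s) j) = src (tnth (seseq t) j).
  by have [+ _] := seP s; have [+ _] := seP t => /(_ j) [_ -> _] /(_ j) [_ _ ->]; rewrite e1.
elim: (_ %/ m) => //= q IH e; rewrite IH // fmor_comp //.
by elim: q {IH} => //= q IH; rewrite tgt_fmor src_fmor IH.
Qed.

Definition divided_phi : functor divided_category divided_category :=
  @free_functor divided_germ divided_germ Dshift sshift
    (fun _ => erefl) (fun _ => erefl) sshift_one sshift_prod.

Definition divided_Delta (f : ob divided_category) : mor divided_category :=
  @free_edge divided_germ (sDelta f).

End Divided.

Arguments divided_category {C phi Delta m} hm gar.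
Arguments divided_phi {C phi Delta m} hm gar.
Arguments divided_Delta {C phi Delta m} hm gar f.

(* Main.v *)
From Stdlib Require Import Relation_Operators.
Require Import Defs.
From mathcomp Require Import all_boot.
From mathcomp Require Import boolp.

(** Write [f.[k]] for the terms of an object [f] of the divided category,
    extended to all [k : nat] by [phi].  An edge [s : f -> g] satisfies
    [f.[k] ;; s.[k.+1] = s.[k] ;; g.[k]] for all [k]: it is a ladder between the
    two infinite [phi]-periodic paths [f] and [g].  Ladders compose
    termwise, so every morphism of the divided category has an underlying
    ladder, its sequence of rungs.  The heart of the proof is that this is an
    isomorphism of categories: a morphism is determined by its source and
    its rungs ([rungs_inj]), and every ladder comes from a morphism
    ([rungs_surj]).

    Granting this, the Garside axioms are read off termwise from the original
    category.  Homogeneity and cancellation are immediate.  If [s] and [t] are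
    ladders from [f], the termwise meets [d.[k]] satisfy
    [d.[k] <= f.[k] ;; d.[k.+1]], because left multiplication commutes with
    meets, and the termwise joins satisfy the same inequality; this is
    exactly what is needed for them to be the rungs of a ladder
    ([ladder_target]: the missing side is obtained by division, and its first
    [m] terms again multiply to [Delta] by naturality of [Delta]).  Divisors
    and the dual order are treated in the same way.

    Both halves of the isomorphism rest on the greedy head of a ladder [s]
    from [f], the termwise meet of [s] and [f].  As [f] itself is a ladder,
    namely [Delta], the head is a ladder, and it is an edge because its rungs
    divide those of [f].
    - If the head is trivial then [s] is trivial ([ladder_coprime]), so by
      induction on the length each ladder is a product of edges.
    - Every morphism can be rewritten, with the relations of the germ, so
      that its first edge is the head of its ladder ([divided_head]).  Two
      morphisms with the same ladder therefore begin with the same edge, and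
      injectivity follows by cancelling it and inducting on the length.

    Finally, the head of an atom is the atom itself, so an atom is an edge
    and divides [Delta]. *)

Set Implicit Arguments.
Unset Strict Implicit.
Unset Printing Implicit Defensive.

(** * Orders, lattices and bijections *)

Lemma inj_surj_bijective (A B : Type) (f : A -> B) :
  injective f -> (forall y, exists x, f x = y) -> bijective f.
Proof. by move=> fI /choice [g gK]; exists g => // x; apply: fI. Qed.

Definition glb (T : Type) (P : T -> Prop) (le : T -> T -> Prop) (a b k : T) :=
  [/\ P k, le k a, le k b & forall c, P c -> le c a -> le c b -> le c k].

Definition lub (T : Type) (P : T -> Prop) (le : T -> T -> Prop) :=
  glb P (fun a b => le b a).

(** The shape in which both lattice axioms are transferred: [ev a i] will be
    the [i]-th rung of the morphism [a]. *)
Lemma lattice_pointwise (I T U : Type) (P : T -> Prop) (leT : T -> T -> Prop)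
    (Q : I -> U -> Prop) (leU : U -> U -> Prop) (ev : T -> I -> U) :
  (forall i, is_lattice (Q i) leU) ->
  (forall a i, P a -> Q i (ev a i)) ->
  (forall a b, P a -> P b -> (forall i, ev a i = ev b i) -> a = b) ->
  (forall a b, P a -> P b -> leT a b <-> forall i, leU (ev a i) (ev b i)) ->
  (forall a b, P a -> P b -> exists j, P j /\
     forall i, lub (Q i) leU (ev a i) (ev b i) (ev j i)) ->
  (forall a b, P a -> P b -> exists j, P j /\
     forall i, glb (Q i) leU (ev a i) (ev b i) (ev j i)) ->
  is_lattice P leT.
Proof.
move=> lat PQ evI leE joins meets; split.
- by move=> a Pa; apply/leE => // i; apply: lat_refl (lat i) _ (PQ _ _ Pa).
- move=> a b c Pa Pb Pc /leE leab /leE lebc; apply/leE => // i.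
  apply: (lat_trans (lat i)) (leab _ _ i) (lebc _ _ i) => //; exact: PQ.
- move=> a b Pa Pb /leE leab /leE leba; apply: evI => // i.
  apply: (lat_anti (lat i)) (leab _ _ i) (leba _ _ i) => //; exact: PQ.
- move=> a b Pa Pb; have [j [Pj jP]] := joins a b Pa Pb; exists j; split=> //.
  + by apply/leE => // i; case: (jP i).
  + by apply/leE => // i; case: (jP i).
  move=> c Pc /leE leac /leE lebc; apply/leE => // i.
  case: (jP i) => _ _ _; apply; [exact: PQ|exact: leac|exact: lebc].
- move=> a b Pa Pb; have [j [Pj jP]] := meets a b Pa Pb; exists j; split=> //.
  + by apply/leE => // i; case: (jP i).
  + by apply/leE => // i; case: (jP i).
  move=> c Pc /leE leca /leE lecb; apply/leE => // i.
  case: (jP i) => _ _ _; apply; [exact: PQ|exact: leca|exact: lecb].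
Qed.

(** * Divisibility in a Garside category *)

Section Divisibility.
Variables (C : category) (phi : functor C C) (Delta : ob C -> mor C).
Hypothesis gar : is_garside phi Delta.
Local Notation ldiv := (@left_div C).
Local Notation rdiv := (@right_div C).
Local Notation from x := (fun f : mor C => src f = x).
Local Notation into x := (fun f : mor C => tgt f = x).

Lemma mcompIr (f g b : mor C) :
  tgt f = src b -> tgt g = src b -> src f = src g -> f ;; b = g ;; b -> f = g.
Proof.
move=> fb gb fg e.
apply: (@gar_cancellative _ _ _ gar (idm (src f)) f g b); rewrite ?tgt_idm //.
by rewrite mcomp1l fg mcomp1l.
Qed.

Lemma ldiv_src (a b : mor C) : ldiv a b -> src a = src b.
Proof. by move=> [h [e ->]]; rewrite src_mcomp. Qed.

Lemma rdiv_tgt (a b : mor C) : rdiv a b -> tgt a = tgt b.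
Proof. by move=> [h [e ->]]; rewrite tgt_mcomp. Qed.

Lemma ldiv_mulr (a b c : mor C) : tgt b = src c -> ldiv a b -> ldiv a (b ;; c).
Proof.
move=> bc [h [ah e]]; subst b; rewrite tgt_mcomp // in bc.
by exists (h ;; c); rewrite src_mcomp // mcompA.
Qed.

Lemma rdiv_mull (a b c : mor C) : tgt c = src b -> rdiv a b -> rdiv a (c ;; b).
Proof.
move=> bc [h [ah e]]; subst b; rewrite src_mcomp // in bc.
by exists (c ;; h); rewrite tgt_mcomp // mcompA.
Qed.

Lemma ldiv_refl (a : mor C) : ldiv a a.
Proof. by exists (idm (tgt a)); rewrite src_idm mcomp1r. Qed.

Lemma rdiv_refl (a : mor C) : rdiv a a.
Proof. by exists (idm (src a)); rewrite tgt_idm mcomp1l. Qed.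

Lemma ldiv_trans (a b c : mor C) : ldiv a b -> ldiv b c -> ldiv a c.
Proof. by move=> ab [h [bh ->]]; apply: ldiv_mulr. Qed.

Lemma rdiv_trans (a b c : mor C) : rdiv a b -> rdiv b c -> rdiv a c.
Proof. by move=> ab [h [bh ->]]; apply: rdiv_mull. Qed.

Lemma ldiv_mul2l (f a b : mor C) : tgt f = src a -> tgt f = src b ->
  ldiv (f ;; a) (f ;; b) <-> ldiv a b.
Proof.
move=> fa fb; split=> [[h [ah e]]|[h [ah e]]]; exists h; subst.
  rewrite tgt_mcomp // in ah; split=> //.
  apply: (mcompIl gar (a := f)); rewrite ?src_mcomp ?mcompA ?e //.
  by rewrite tgt_mcomp // -(tgt_mcomp fb) e tgt_mcomp // tgt_mcomp.
by rewrite tgt_mcomp // mcompA.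
Qed.

Lemma rdiv_mul2r (f a b : mor C) : tgt a = src f -> tgt b = src f ->
  rdiv (a ;; f) (b ;; f) <-> rdiv a b.
Proof.
move=> fa fb; split=> [[h [ah e]]|[h [ah e]]]; exists h; subst.
  rewrite src_mcomp // in ah; split=> //.
  apply: (mcompIr (b := f)); rewrite ?tgt_mcomp -?mcompA ?e //.
  by rewrite src_mcomp // -(src_mcomp fb) e src_mcomp // src_mcomp.
by rewrite src_mcomp // mcompA.
Qed.

Lemma phi_ob_inj : injective (fob phi).
Proof. by have [/bij_inj] := gar_phi gar. Qed.

Lemma phi_mor_inj : injective (fmor phi).
Proof. by have [_ /bij_inj] := gar_phi gar. Qed.

Lemma phi_mor_surj b : exists a, fmor phi a = b.
Proof. by have [_ [g _ gK]] := gar_phi gar; exists (g b). Qed.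

Lemma ldiv_phi a b : ldiv (fmor phi a) (fmor phi b) <-> ldiv a b.
Proof.
split=> [[h]|[h [ah ->]]]; last first.
  by exists (fmor phi h); rewrite tgt_fmor src_fmor ah fmor_comp.
have [{}h <-] := phi_mor_surj h; rewrite tgt_fmor src_fmor.
move=> [/phi_ob_inj ah]; rewrite -fmor_comp // => /phi_mor_inj ->.
by exists h.
Qed.

Lemma rdiv_phi a b : rdiv (fmor phi a) (fmor phi b) <-> rdiv a b.
Proof.
split=> [[h]|[h [ah ->]]]; last first.
  by exists (fmor phi h); rewrite tgt_fmor src_fmor ah fmor_comp.
have [{}h <-] := phi_mor_surj h; rewrite tgt_fmor src_fmor.
move=> [/phi_ob_inj ah]; rewrite -fmor_comp // => /phi_mor_inj ->.
by exists h.
Qed.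

(** Stated for an abstract order so that it applies to meets and, with the
    order reversed, to joins, on either side. *)
Lemma glb_phi (P P' : mor C -> Prop) (le : mor C -> mor C -> Prop) a b k :
  (forall c d, le (fmor phi c) (fmor phi d) <-> le c d) ->
  (forall c, P' (fmor phi c) <-> P c) ->
  glb P le a b k -> glb P' le (fmor phi a) (fmor phi b) (fmor phi k).
Proof.
move=> lephi Pphi [Pk ka kb kP]; split; rewrite ?Pphi ?lephi // => c.
have [{}c <-] := phi_mor_surj c.
by rewrite Pphi !lephi; apply: kP.
Qed.

Lemma from_phi x c : src (fmor phi c) = fob phi x <-> src c = x.
Proof. by rewrite src_fmor; split=> [/phi_ob_inj|->]. Qed.

Lemma into_phi x c : tgt (fmor phi c) = fob phi x <-> tgt c = x.
Proof. by rewrite tgt_fmor; split=> [/phi_ob_inj|->]. Qed.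

(** The meet of [f ;; a] and [f ;; b] is [f ;; d]: being a multiple of [f], it
    has the form [f ;; e'] with [e'] a common divisor of [a] and [b]. *)
Lemma ldiv_mul_glb f x a b d :
  tgt f = src a -> tgt f = src b -> glb (from (tgt f)) ldiv a b d ->
  ldiv x (f ;; a) -> ldiv x (f ;; b) -> ldiv x (f ;; d).
Proof.
move=> fa fb [sd da db dP] xa xb.
have [] := @lat_meet _ _ _ (gar_lattice_src gar (src f)) (f ;; a) (f ;; b).
- exact: src_mcomp.
- exact: src_mcomp.
move=> e [se ea eb eP].
have fe : ldiv f e by apply: eP => //; apply: ldiv_mulr => //; apply: ldiv_refl.
have [e' [fe' ee]] := fe; subst e.
apply: (ldiv_trans (b := f ;; e')).
  by apply: eP => //; rewrite (ldiv_src xa) src_mcomp.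
apply/ldiv_mul2l => //; apply: dP => //.
- exact: (ldiv_mul2l fe' fa).1.
- exact: (ldiv_mul2l fe' fb).1.
Qed.

Lemma rdiv_mul_glb f x a b d :
  tgt a = src f -> tgt b = src f -> glb (into (src f)) rdiv a b d ->
  rdiv x (a ;; f) -> rdiv x (b ;; f) -> rdiv x (d ;; f).
Proof.
move=> fa fb [sd da db dP] xa xb.
have [] := @lat_meet _ _ _ (gar_lattice_tgt gar (tgt f)) (a ;; f) (b ;; f).
- exact: tgt_mcomp.
- exact: tgt_mcomp.
move=> e [se ea eb eP].
have fe : rdiv f e by apply: eP => //; apply: rdiv_mull => //; apply: rdiv_refl.
have [e' [fe' ee]] := fe; subst e.
apply: (rdiv_trans (b := e' ;; f)).
  by apply: eP => //; rewrite (rdiv_tgt xa) tgt_mcomp.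
apply/rdiv_mul2r => //; apply: dP => //.
- exact: (rdiv_mul2r fe' fa).1.
- exact: (rdiv_mul2r fe' fb).1.
Qed.

Lemma is_id_ldiv (a b : mor C) : is_id b -> ldiv a b -> is_id a.
Proof.
have [l [lM l0]] := gar_homogeneous gar.
move=> /l0 b0 [h [ah e]]; apply/l0/eqP.
by move: b0; rewrite e lM // => /eqP; rewrite addn_eq0 => /andP[].
Qed.

Lemma atom_ldiv (f : mor C) : ~ is_id f -> exists a, is_atom a /\ ldiv a f.
Proof.
have [l [lM l0]] := gar_homogeneous gar.
have [n] := ubnP (l f); elim: n f => // n IH f ln nf.
have [af|] := pselect (is_atom f).
  by exists f; split=> //; apply: ldiv_refl.
move=> /not_andP[//|/contrapT [g [h [gh ng nh e]]]].
have lh : 0 < l h by rewrite lt0n; apply/eqP => /l0.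
have lg : l g < n.
  by rewrite -ltnS; apply: leq_trans ln; rewrite e lM // !ltnS -addn1 leq_add2l.
have [a [aa ag]] := IH g lg ng.
by exists a; split=> //; rewrite e; apply: ldiv_mulr.
Qed.

End Divisibility.

(** * Segments of infinite paths *)

Section Segments.
Variables (C : category) (phi : functor C C).
Implicit Types a b c : nat -> mor C.

Definition segment a k n : mor C :=
  composite (src (a k)) [seq a i | i <- iota k n].

Definition composable a := forall k, tgt (a k) = src (a k.+1).

Lemma segmentS a k n : composable a ->
  segment a k n.+1 = a k ;; segment a k.+1 n.
Proof. by move=> ca; rewrite /segment /= ca. Qed.

Lemma chain_segment a k n : composable a ->
  chain (@src C) (@tgt C) (src (a k)) [seq a i | i <- iota k n].
Proof.
by move=> ca; elim: n k => //= n IH k; split=> //; rewrite ca; apply: IH.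
Qed.

Lemma src_segment a k n : composable a -> src (segment a k n) = src (a k).
Proof. by move=> ca; have [] := composite_ends (chain_segment k n ca). Qed.

Lemma tgt_segment a k n : composable a ->
  tgt (segment a k n) = src (a (k + n)).
Proof.
move=> ca; elim: n k => [|n IH] k; first by rewrite /segment /= tgt_idm addn0.
by rewrite segmentS // tgt_mcomp ?src_segment // IH addSnnS.
Qed.

Lemma eq_segment a b k l n : (forall i, a (k + i) = b (l + i)) ->
  segment a k n = segment b l n.
Proof.
move=> e; rewrite /segment; have := e 0; rewrite !addn0 => ->.
congr composite; rewrite -[k]addn0 -[l]addn0 !iotaDl -!map_comp.
exact: eq_map.
Qed.

Lemma segment_phi a k n : composable a ->
  fmor phi (segment a k n) = segment (fmor phi \o a) k n.
Proof.
move=> ca; have cpa : composable (fmor phi \o a).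
  by move=> i /=; rewrite tgt_fmor src_fmor ca.
elim: n k => [|n IH] k; first by rewrite /segment /= fmor_idm src_fmor.
by rewrite !segmentS // fmor_comp ?src_segment // IH.
Qed.

(** Pasting of the [n] commutative squares of a ladder. *)
Lemma segment_ladder a b c k n : composable a -> composable b ->
  (forall i, [/\ src (c i) = src (a i), tgt (c i) = src (b i)
               & a i ;; c i.+1 = c i ;; b i]) ->
  segment a k n ;; c (k + n) = c k ;; segment b k n.
Proof.
move=> ca cb lad; elim: n k => [|n IH] k.
  have [sc tc _] := lad k.
  by rewrite addn0 /segment /= -sc mcomp1l -tc mcomp1r.
have [sc tc sq] := lad k; have [sc' tc' _] := lad k.+1.
have [sc'' _ _] := lad (k + n.+1).
rewrite !segmentS // -mcompA ?src_segment ?tgt_segment ?addSnnS //.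
rewrite -addSnnS IH mcompA ?src_segment ?ca ?sc' // sq -mcompA ?src_segment //.
Qed.

End Segments.

(** * Ladders between objects of the divided category *)

Section Ladders.
Variables (C : category) (phi : functor C C) (Delta : ob C -> mor C).
Variables (m : nat) (hm : 0 < m).
Hypothesis gar : is_garside phi Delta.
Local Notation ldiv := (@left_div C).
Local Notation rdiv := (@right_div C).
Local Notation from x := (fun f : mor C => src f = x).
Local Notation into x := (fun f : mor C => tgt f = x).
Local Notation "s .[ k ]" := (ext (fmor phi) hm s k).
Local Notation D := (D Delta hm).
Local Coercion Dseq : Defs.D >-> tuple_of.
Implicit Types (f g h : D) (s t u : m.-tuple (mor C)).

Lemma ext_ind (P : nat -> Prop) : (forall i : 'I_m, P i) ->
  (forall k, P k -> P (m + k)) -> forall k, P k.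
Proof.
move=> P0 PS k; rewrite (divn_eq k m); elim: (k %/ m) => [|q IH].
  by rewrite mul0n; exact: (P0 (Ordinal (ltn_pmod k hm))).
by rewrite mulSn -addnA; apply: PS.
Qed.

(** Rungs are chosen for the first [m] indices only and then extended by [phi],
    so that no canonical choice of meets, joins or quotients is needed. *)
Lemma equivariant_choice (R : nat -> mor C -> Prop) :
  (forall k, exists a, R k a) ->
  (forall k a, R k a -> R (m + k) (fmor phi a)) ->
  exists s, forall k, R k s.[k].
Proof.
move=> /choice [a Ra] Rphi; exists [tuple a i | i < m].
elim/ext_ind => [i|k]; first by rewrite ext_ord tnth_mktuple.
by rewrite ext_add; apply: Rphi.
Qed.

Lemma eq_ext s t : (forall k, s.[k] = t.[k]) -> s = t.
Proof. by move=> e; apply: (@ext_inj _ (fmor phi) m hm) => i. Qed.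

Lemma eq_D f g : (forall k, f.[k] = g.[k]) -> f = g.
Proof. by move=> e; apply/D_inj/eq_ext. Qed.

Lemma D_composable f : composable (fun k => f.[k]).
Proof. by move=> k; apply: D_tgt. Qed.

Lemma tuple_segment s : tval s = [seq s.[i] | i <- iota 0 m].
Proof.
apply: (@eq_from_nth _ s.[0]); first by rewrite size_map size_iota size_tuple.
move=> i; rewrite size_tuple => im.
rewrite (nth_map 0) ?size_iota // nth_iota // add0n.
by rewrite -(tnth_nth _ _ (Ordinal im)) -(ext_ord (fmor phi) hm).
Qed.

Lemma tnth_ext0 s : tnth s (Ordinal hm) = s.[0].
Proof. by rewrite -(ext_ord (fmor phi) hm). Qed.

Lemma ext_period s : s.[m] = fmor phi s.[0].
Proof. by have := ext_add (fmor phi) hm s 0; rewrite addn0. Qed.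

Lemma in_D_segment s : composable (fun k => s.[k]) ->
  in_D Delta hm s <-> segment (fun k => s.[k]) 0 m = Delta (src s.[0]).
Proof.
move=> cs; rewrite /in_D tnth_ext0 tuple_segment; split=> [[]//|e].
by split=> //; apply: (chain_segment 0 m cs).
Qed.

(** Any [m] consecutive terms of an object multiply to [Delta], since the
    [k]-th shift of an object is an object. *)
Lemma D_segment f k : segment (fun i => f.[k + i]) 0 m = Delta (src f.[k]).
Proof.
have Hk := in_D_iter_shift gar k (svalP f).
have := (in_D_segment (D_composable (exist _ _ Hk))).1 Hk.
rewrite /= ext_iter_shift addn0 => <-.
by apply: eq_segment => i; rewrite ext_iter_shift.
Qed.

Definition ladder f g s : Prop := forall k,
  [/\ src s.[k] = src f.[k], tgt s.[k] = src g.[k]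
    & f.[k] ;; s.[k.+1] = s.[k] ;; g.[k]].

(** The quotients [g.[k]] form an object: pasting squares gives
    [s.[0] ;; (g.[0] ;; ... ;; g.[m-1]) = Delta ;; phi s.[0]], which is
    [s.[0] ;; Delta] by naturality, and [s.[0]] cancels. *)
Lemma ladder_target f s : (forall k, src s.[k] = src f.[k]) ->
  (forall k, ldiv s.[k] (f.[k] ;; s.[k.+1])) -> exists g, ladder f g s.
Proof.
move=> ss sf.
have fs k : tgt f.[k] = src s.[k.+1] by rewrite ss D_tgt.
pose R k a := tgt s.[k] = src a /\ f.[k] ;; s.[k.+1] = s.[k] ;; a.
have [//|k a [sa e]|g Rg] := @equivariant_choice R.
  split; first by rewrite ext_add tgt_fmor src_fmor sa.
  by rewrite -addnS !ext_add -!fmor_comp // e.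
have cg : composable (fun k => g.[k]).
  move=> k; have [sg e] := Rg k; have [sg' _] := Rg k.+1.
  by rewrite -sg' -(tgt_mcomp sg) -e tgt_mcomp.
have lad k : [/\ src s.[k] = src f.[k], tgt s.[k] = src g.[k]
    & f.[k] ;; s.[k.+1] = s.[k] ;; g.[k]] by have [] := Rg k.
have Hg : in_D Delta hm g; last by exists (exist _ g Hg).
apply/in_D_segment => //.
have [_ tg _] := lad 0.
have := segment_ladder 0 m (D_composable f) cg lad.
rewrite (D_segment f 0) add0n ext_period -ss.
rewrite -(natural_Delta gar) tg => e.
apply: (mcompIl gar (a := s.[0])) (esym e);
  rewrite ?src_segment ?(src_Delta gar) //.
by rewrite tgt_segment // add0n ext_period src_fmor (tgt_Delta gar).
Qed.

(** Dual of [ladder_target]; here it is [s.[m]], the image of [s.[0]] under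
    [phi], that cancels on the right. *)
Lemma ladder_source f s : (forall k, tgt s.[k] = src f.[k]) ->
  (forall k, rdiv s.[k.+1] (s.[k] ;; f.[k])) -> exists g, ladder g f s.
Proof.
move=> ts sf.
pose R k a := tgt a = src s.[k.+1] /\ s.[k] ;; f.[k] = a ;; s.[k.+1].
have [//|k a [sa e]|g Rg] := @equivariant_choice R.
  split; first by rewrite -addnS ext_add tgt_fmor src_fmor sa.
  by rewrite -addnS !ext_add -!fmor_comp // e.
have sg k : src g.[k] = src s.[k].
  by have [tg e] := Rg k; rewrite -(src_mcomp tg) -e src_mcomp.
have cg : composable (fun k => g.[k]).
  by move=> k; have [-> _] := Rg k; rewrite sg.
have lad k : [/\ src s.[k] = src g.[k], tgt s.[k] = src f.[k]
    & g.[k] ;; s.[k.+1] = s.[k] ;; f.[k]] by have [_ ->] := Rg k; rewrite sg.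
have Hg : in_D Delta hm g; last by exists (exist _ g Hg).
apply/in_D_segment => //.
have tg : tgt (segment (fun k => g.[k]) 0 m) = src (fmor phi s.[0]).
  by rewrite tgt_segment // add0n ext_period !src_fmor sg.
have := segment_ladder 0 m cg (D_composable f) lad.
rewrite (D_segment f 0) add0n ext_period -ts.
rewrite (natural_Delta gar) => /(mcompIr gar); rewrite sg; apply=> //.
  by rewrite (tgt_Delta gar) src_fmor.
by rewrite src_segment // (src_Delta gar) sg.
Qed.

Lemma ladder_unique_target f g h s : ladder f g s -> ladder f h s -> g = h.
Proof.
move=> lg lh; apply: eq_D => k; have [_ sg eg] := lg k; have [_ sh eh] := lh k.
have [_ sg' _] := lg k.+1; have [_ sh' _] := lh k.+1.
apply: (mcompIl gar (a := s.[k])) => //; last by rewrite -eg.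
by rewrite !(D_tgt gar) -sg' -sh'.
Qed.

Lemma ladder_comp f g h s t u : ladder f g s -> ladder g h t ->
  (forall k, u.[k] = s.[k] ;; t.[k]) -> ladder f h u.
Proof.
move=> ls lt e k; have [ss ts sq] := ls k; have [st tt tq] := lt k.
have [ss' ts' _] := ls k.+1; have [st' tt' _] := lt k.+1.
have st0 : tgt s.[k] = src t.[k] by rewrite st.
have st1 : tgt s.[k.+1] = src t.[k.+1] by rewrite st'.
rewrite !e src_mcomp // tgt_mcomp //; split=> //.
rewrite mcompA ?ss' ?(D_tgt gar) // sq -mcompA ?st' ?(D_tgt gar) //.
by rewrite tq mcompA.
Qed.

Lemma ladder_ldiv f g h s t : ladder f g s -> ladder f h t ->
  (forall k, ldiv s.[k] t.[k]) ->
  exists2 u, ladder g h u & forall k, t.[k] = s.[k] ;; u.[k].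
Proof.
move=> ls lt st.
pose R k a := tgt s.[k] = src a /\ t.[k] = s.[k] ;; a.
have [//|k a [sa e]|u Ru] := @equivariant_choice R.
  by rewrite /R !ext_add tgt_fmor src_fmor sa e fmor_comp.
exists u => k; last by case: (Ru k).
have [ss ts sq] := ls k; have [src_t tt tq] := lt k; have [su e] := Ru k.
have [ss' ts' _] := ls k.+1; have [src_t' tt' _] := lt k.+1.
have [su' e'] := Ru k.+1.
have tu : tgt u.[k] = src h.[k] by rewrite -(tgt_mcomp su) -e.
have gu : tgt g.[k] = src u.[k.+1] by rewrite (D_tgt gar) -ts'.
split=> //; first by rewrite -su.
apply: (mcompIl gar (a := s.[k])).
- by rewrite src_mcomp.
- by rewrite src_mcomp.
- by rewrite !tgt_mcomp // -(tgt_mcomp su') -e' tt' (D_tgt gar).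
rewrite !mcompA // -sq -e -tq e' mcompA ?ss' ?(D_tgt gar) //.
Qed.

Lemma ladder_rdiv f g h s t : ladder g f s -> ladder h f t ->
  (forall k, rdiv s.[k] t.[k]) ->
  exists2 u, ladder h g u & forall k, t.[k] = u.[k] ;; s.[k].
Proof.
move=> ls lt st.
pose R k a := tgt a = src s.[k] /\ t.[k] = a ;; s.[k].
have [//|k a [sa e]|u Ru] := @equivariant_choice R.
  by rewrite /R !ext_add tgt_fmor src_fmor sa e fmor_comp.
exists u => k; last by case: (Ru k).
have [ss ts sq] := ls k; have [src_t tt tq] := lt k; have [su e] := Ru k.
have [ss' ts' _] := ls k.+1; have [src_t' tt' _] := lt k.+1.
have [su' e'] := Ru k.+1.
have eu : src u.[k] = src h.[k] by rewrite -(src_mcomp su) -e.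
have eu' : src u.[k.+1] = src h.[k.+1] by rewrite -(src_mcomp su') -e'.
have hu : tgt h.[k] = src u.[k.+1] by rewrite (D_tgt gar) eu'.
split=> //; first by rewrite su.
have ug : tgt u.[k] = src g.[k] by rewrite su.
have gs : tgt g.[k] = src s.[k.+1] by rewrite (D_tgt gar) ss'.
apply: (mcompIr gar (b := s.[k.+1])).
- by rewrite tgt_mcomp.
- by rewrite tgt_mcomp.
- by rewrite !src_mcomp.
by rewrite -!mcompA // -e' sq tq mcompA -?e //.
Qed.

Lemma from_src_phi f k c :
  src (fmor phi c) = src f.[m + k] <-> src c = src f.[k].
Proof. by rewrite ext_add (src_fmor _ f.[k]); apply: (from_phi gar). Qed.

Lemma into_src_phi f k c :
  tgt (fmor phi c) = src f.[m + k] <-> tgt c = src f.[k].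
Proof. by rewrite ext_add (src_fmor _ f.[k]); apply: (into_phi gar). Qed.

(** [d.[k]] divides [s.[k] ;; g.[k] = f.[k] ;; s.[k.+1]] and likewise
    [f.[k] ;; t.[k.+1]], hence their meet [f.[k] ;; d.[k.+1]]. *)
Lemma ladder_glb f g h s t : ladder f g s -> ladder f h t ->
  exists x, exists2 d, ladder f x d &
    forall k, glb (from (src f.[k])) ldiv s.[k] t.[k] d.[k].
Proof.
move=> ls lt; pose R k a := glb (from (src f.[k])) ldiv s.[k] t.[k] a.
have [k|k a|d Rd] := @equivariant_choice R.
- have [ss _ _] := ls k; have [st _ _] := lt k.
  by have [d dP] := lat_meet (gar_lattice_src gar (src f.[k])) ss st; exists d.
- rewrite /R !(ext_add _ _ s) !(ext_add _ _ t).
  apply: (glb_phi gar); [exact: (ldiv_phi gar)|exact: from_src_phi].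
have [|k|x lx] := @ladder_target f d; last by exists x; exists d.
- by move=> k; case: (Rd k).
have [ss ts sq] := ls k; have [st tt tq] := lt k.
have [ss' _ _] := ls k.+1; have [st' _ _] := lt k.+1.
have [_ ds dt _] := Rd k.
apply: (ldiv_mul_glb gar (a := s.[k.+1]) (b := t.[k.+1])).
- by rewrite ss' (D_tgt gar).
- by rewrite st' (D_tgt gar).
- by rewrite (D_tgt gar); apply: Rd.
- by rewrite sq; apply: ldiv_mulr.
- by rewrite tq; apply: ldiv_mulr.
Qed.

(** [f.[k] ;; d.[k.+1]] is a common multiple of [s.[k]] and [t.[k]], hence a
    multiple of their join [d.[k]]. *)
Lemma ladder_lub f g h s t : ladder f g s -> ladder f h t ->
  exists x, exists2 d, ladder f x d &
    forall k, lub (from (src f.[k])) ldiv s.[k] t.[k] d.[k].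
Proof.
move=> ls lt; pose R k a := lub (from (src f.[k])) ldiv s.[k] t.[k] a.
have [k|k a|d Rd] := @equivariant_choice R.
- have [ss _ _] := ls k; have [st _ _] := lt k.
  by have [d dP] := lat_join (gar_lattice_src gar (src f.[k])) ss st; exists d.
- rewrite /R !(ext_add _ _ s) !(ext_add _ _ t).
  apply: (glb_phi gar); [|exact: from_src_phi].
  exact: (fun b c => ldiv_phi gar c b).
have [|k|x lx] := @ladder_target f d; last by exists x; exists d.
- by move=> k; case: (Rd k).
have [ss ts sq] := ls k; have [st tt tq] := lt k.
have [ss' _ _] := ls k.+1; have [st' _ _] := lt k.+1.
have [sd' ds' dt' _] := Rd k.+1; have [_ _ _ dP] := Rd k.
have fs : tgt f.[k] = src s.[k.+1] by rewrite ss' (D_tgt gar).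
have ft : tgt f.[k] = src t.[k.+1] by rewrite st' (D_tgt gar).
have fd : tgt f.[k] = src d.[k.+1] by rewrite sd' (D_tgt gar).
apply: dP; first by rewrite src_mcomp.
- apply: (ldiv_trans (b := f.[k] ;; s.[k.+1])).
    by rewrite sq; apply: ldiv_mulr => //; apply: ldiv_refl.
  by apply/(ldiv_mul2l gar).
- apply: (ldiv_trans (b := f.[k] ;; t.[k.+1])).
    by rewrite tq; apply: ldiv_mulr => //; apply: ldiv_refl.
  by apply/(ldiv_mul2l gar).
Qed.

Lemma ladder_right_glb f g h s t : ladder g f s -> ladder h f t ->
  exists x, exists2 d, ladder x f d &
    forall k, glb (into (src f.[k])) rdiv s.[k] t.[k] d.[k].
Proof.
move=> ls lt; pose R k a := glb (into (src f.[k])) rdiv s.[k] t.[k] a.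
have [k|k a|d Rd] := @equivariant_choice R.
- have [_ ss _] := ls k; have [_ st _] := lt k.
  by have [d dP] := lat_meet (gar_lattice_tgt gar (src f.[k])) ss st; exists d.
- rewrite /R !(ext_add _ _ s) !(ext_add _ _ t).
  apply: (glb_phi gar); [exact: (rdiv_phi gar)|exact: into_src_phi].
have [|k|x lx] := @ladder_source f d; last by exists x; exists d.
- by move=> k; case: (Rd k).
have [ss ts sq] := ls k; have [st tt tq] := lt k.
have [ss' _ _] := ls k.+1; have [st' _ _] := lt k.+1.
have [_ ds dt _] := Rd k.+1.
apply: (rdiv_mul_glb gar (a := s.[k]) (b := t.[k])) => //.
- exact: Rd.
- by rewrite -sq; apply: rdiv_mull; rewrite ?ss' ?(D_tgt gar).
- by rewrite -tq; apply: rdiv_mull; rewrite ?st' ?(D_tgt gar).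
Qed.

Lemma ladder_right_lub f g h s t : ladder g f s -> ladder h f t ->
  exists x, exists2 d, ladder x f d &
    forall k, lub (into (src f.[k])) rdiv s.[k] t.[k] d.[k].
Proof.
move=> ls lt; pose R k a := lub (into (src f.[k])) rdiv s.[k] t.[k] a.
have [k|k a|d Rd] := @equivariant_choice R.
- have [_ ss _] := ls k; have [_ st _] := lt k.
  by have [d dP] := lat_join (gar_lattice_tgt gar (src f.[k])) ss st; exists d.
- rewrite /R !(ext_add _ _ s) !(ext_add _ _ t).
  apply: (glb_phi gar); [|exact: into_src_phi].
  exact: (fun b c => rdiv_phi gar c b).
have [|k|x lx] := @ladder_source f d; last by exists x; exists d.
- by move=> k; case: (Rd k).
have [ss ts sq] := ls k; have [st tt tq] := lt k.
have [ss' _ _] := ls k.+1; have [st' _ _] := lt k.+1.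
have [td ds dt _] := Rd k; have [_ _ _ dP] := Rd k.+1.
have gs : tgt g.[k] = src s.[k.+1] by rewrite ss' (D_tgt gar).
have ht : tgt h.[k] = src t.[k.+1] by rewrite st' (D_tgt gar).
apply: dP; first by rewrite tgt_mcomp // (D_tgt gar).
- apply: (rdiv_trans (b := s.[k] ;; f.[k])).
    by rewrite -sq; apply: rdiv_mull => //; apply: rdiv_refl.
  by apply/(rdiv_mul2r gar).
- apply: (rdiv_trans (b := t.[k] ;; f.[k])).
    by rewrite -tq; apply: rdiv_mull => //; apply: rdiv_refl.
  by apply/(rdiv_mul2r gar).
Qed.

Lemma ext_Dshift f k : (Dshift gar f).[k] = f.[k.+1].
Proof. exact: ext_shift. Qed.

Lemma ladder_Delta f : ladder f (Dshift gar f) f.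
Proof. by move=> k; rewrite ext_Dshift (D_tgt gar). Qed.

(** If [r] divides both [s.[k]] and a product of terms of [f] beginning with
    [f.[k]], then the quotient of the join of [r] and [f.[k]] by [f.[k]]
    divides [s.[k.+1]] and the product of the remaining terms.  By induction
    on the number of terms that quotient is trivial, so [r] divides [f.[k]]
    and is trivial.  With [m] terms the product is [Delta], which every atom
    divides, so no atom divides [s.[k]]. *)
Lemma ladder_coprime f g s : ladder f g s ->
  (forall k a, ldiv a s.[k] -> ldiv a f.[k] -> is_id a) ->
  forall k, is_id s.[k].
Proof.
move=> ls cop.
have fs k : tgt f.[k] = src s.[k.+1].
  by have [-> _ _] := ls k.+1; rewrite (D_tgt gar).
have cf := D_composable f.
have key n k a : ldiv a s.[k] ->
    ldiv a (segment (fun i => f.[i]) k n) -> is_id a.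
  elim: n k a => [|n IH] k a as_ af.
    apply: (is_id_ldiv gar) af; rewrite /segment /=.
    by rewrite /is_id src_idm.
  have [ss ts sq] := ls k.
  rewrite segmentS // in af.
  have [|//|j [sj fj aj jP]] :=
      lat_join (gar_lattice_src gar (src f.[k])) (a := f.[k]) (b := a) _ _.
  - by [].
  - by rewrite (ldiv_src as_) ss.
  have [r [fr ej]] := fj.
  have fS : tgt f.[k] = src (segment (fun i => f.[i]) k.+1 n).
    by rewrite src_segment // (D_tgt gar).
  have rid : is_id r.
    apply: (IH k.+1).
      apply/(ldiv_mul2l gar (f := f.[k])) => //; rewrite -ej.
      apply: jP; rewrite ?src_mcomp //; first exact/ldiv_mulr/ldiv_refl.
      by rewrite sq; apply: ldiv_mulr.
    apply/(ldiv_mul2l gar (f := f.[k])) => //; rewrite -ej.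
    apply: jP; rewrite ?src_mcomp //; exact/ldiv_mulr/ldiv_refl.
  apply: cop as_ _; move: aj; rewrite ej rid -fr mcomp1r //.
move=> k; apply: contrapT => /(atom_ldiv gar) [a [aa as_]].
have [nid _] := aa; apply: nid.
apply: (key m k) => //.
have -> : segment (fun i => f.[i]) k m = Delta (src f.[k]).
  by rewrite -D_segment; apply: eq_segment.
have [ss _ _] := ls k; rewrite -ss -(ldiv_src as_).
by have [a' [aa' _ <-]] := gar_atom_simple gar aa; exists a'.
Qed.

Lemma simple_ldiv (a b : mor C) :
  ldiv a b -> is_simple phi Delta b -> is_simple phi Delta a.
Proof.
move=> [h [ah ->]] [b' []]; rewrite src_mcomp // tgt_mcomp // => hb tb e.
by exists (h ;; b'); rewrite src_mcomp // tgt_mcomp // mcompA.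
Qed.

(** Edges are the ladders whose rungs divide the terms of their source. *)
Lemma is_edgeE f g s : is_edge phi Delta hm (Dseq f) (Dseq g) s <->
  ladder f g s /\ forall k, ldiv s.[k] f.[k].
Proof.
split=> [[H [s' H']]|[ls sf]].
  have K k : src s.[k] = src f.[k] /\ tgt s.[k] = src g.[k].
    elim/ext_ind: k => [i|k [ss ts]]; first by rewrite !ext_ord; case: (H i).
    by rewrite !ext_add !src_fmor tgt_fmor ss ts.
  have K' k : f.[k] ;; s.[k.+1] = s.[k] ;; g.[k] /\ ldiv s.[k] f.[k].
    elim/ext_ind: k => [i|k [sq sf]].
      have [e1 e2 e3 e4] := H' i.
      rewrite !(ext_ord _ _ _ i) e4 mcompA // -e2; split=> //.
      by exists (tnth s' i); rewrite e2.
    rewrite -addnS !ext_add (ldiv_phi gar); split=> //.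
    have [ss _] := K k.+1; have [_ ts] := K k.
    by rewrite -!fmor_comp ?sq // (D_tgt gar).
  by split=> k; [have [? ?] := K k; have [? _] := K' k|have [] := K' k].
pose R k a := tgt s.[k] = src a /\ f.[k] = s.[k] ;; a.
have [//|k a [sa e]|s' Rs'] := @equivariant_choice R.
  by rewrite /R !ext_add tgt_fmor src_fmor sa e fmor_comp.
split=> [i|].
  have [ss ts _] := ls i; rewrite -!(ext_ord (fmor phi) hm); split=> //.
  exact/(simple_ldiv (sf i))/D_simple.
exists s' => i; rewrite -!(ext_ord (fmor phi) hm).
have [ss ts sq] := ls i; have [ss' _ _] := ls i.+1; have [sa e] := Rs' i.
have ts' : tgt s'.[i] = src s.[i.+1].
  by rewrite -(tgt_mcomp sa) -e ss' (D_tgt gar).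
split=> //; apply: (mcompIl gar (a := s.[i])); rewrite ?src_mcomp //.
  by rewrite tgt_mcomp // (D_tgt gar); have [_ <-] := ls i.+1.
by rewrite -sq mcompA // -e.
Qed.

End Ladders.

(** * Morphisms out of the free category on a germ *)

Section FreeCategoryTheory.
Variable G : germ.
Local Notation F := (free_category G).

Lemma src_free_edge (e : gedge G) : src (free_edge e) = gsrc e.
Proof. exact: free_src_class. Qed.

Lemma tgt_free_edge (e : gedge G) : tgt (free_edge e) = gtgt e.
Proof. exact: free_tgt_class. Qed.

Lemma free_edge_one x : free_edge (gone G x) = @idm F x.
Proof.
apply/classP/rst_step; split; first exact: gsrc_one.
exact: (step_one [::] x [::]).
Qed.

Lemma free_edge_prod (s t u : gedge G) :
  gprod s t u -> free_edge s ;; free_edge t = free_edge u.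
Proof.
move=> p; have [st us _] := gprod_typed p.
rewrite /= free_comp_class //; apply/classP/rst_step; split.
  by rewrite wsrc_cat /= us.
by rewrite wedges_cat //; apply: (step_prod [::] [::] p).
Qed.

Lemma free_mor_ind (P : mor F -> Prop) :
  (forall x, P (idm x)) ->
  (forall (e : gedge G) (c : mor F), gtgt e = src c ->
     P c -> P (free_edge e ;; c)) ->
  forall c, P c.
Proof.
move=> Pid Pcons c; rewrite -(repK c); case: (rep c) => x es H.
elim: es x H => [|e es IH] x H.
  have -> : Walk H = wnil x by apply: walk_inj.
  exact: Pid.
have [ex H'] := H; have := Pcons e (class (Walk H')).
rewrite /= free_src_class free_comp_class //.
have -> : wcat (wedge1 e) (Walk H') = Walk H.
  by apply: walk_inj; rewrite ?wsrc_cat ?wedges_cat.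
by apply; last exact: IH.
Qed.

End FreeCategoryTheory.

Section FreeLift.
Variables (G : germ) (B : category).
Variables (v : gvert G -> ob B) (a : gedge G -> mor B).
Hypothesis a_src : forall e, src (a e) = v (gsrc e).
Hypothesis a_tgt : forall e, tgt (a e) = v (gtgt e).
Hypothesis a_one : forall x, a (gone G x) = idm (v x).
Hypothesis a_prod : forall s t u, gprod s t u -> a u = a s ;; a t.

Lemma composite_cat (x : ob B) fs gs : chain (@src B) (@tgt B) x (fs ++ gs) ->
  composite x (fs ++ gs) =
  composite x fs ;; composite (last x (map (@tgt B) fs)) gs.
Proof.
elim: fs x => [|f fs IH] x /=.
  by move=> /composite_ends [e _]; rewrite -[in idm x]e mcomp1l.
move=> [_ H]; rewrite IH //; move/chain_cat: H => [Hf Hg].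
have [sf tf] := composite_ends Hf; have [sg _] := composite_ends Hg.
by rewrite mcompA ?sf ?tf ?sg.
Qed.

Lemma chain_lift x es : chain (@gsrc G) (@gtgt G) x es ->
  chain (@src B) (@tgt B) (v x) (map a es).
Proof.
elim: es x => //= e es IH x [<- H]; split; first exact: a_src.
by rewrite a_tgt; apply: IH.
Qed.

Definition walk_lift (p : walk G) : mor B :=
  composite (v (wsrc p)) (map a (wedges p)).

Lemma walk_lift_src p : src (walk_lift p) = v (wsrc p).
Proof. by case: (composite_ends (chain_lift (wedgesP p))). Qed.

Lemma walk_lift_tgt p : tgt (walk_lift p) = v (wtgt p).
Proof.
case: (composite_ends (chain_lift (wedgesP p))) => _ ->; rewrite /wtgt.
elim: (wedges p) (wsrc p) => //= e es IH x; rewrite -IH a_tgt //.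
Qed.

Lemma walk_lift_cat p q : wtgt p = wsrc q ->
  walk_lift (wcat p q) = walk_lift p ;; walk_lift q.
Proof.
move=> pq; have [_ tp] := composite_ends (chain_lift (wedgesP p)).
have := chain_lift (wedgesP (wcat p q)).
rewrite /walk_lift wsrc_cat wedges_cat // map_cat => H.
rewrite composite_cat // -tp.
by have := walk_lift_tgt p; rewrite /walk_lift pq => ->.
Qed.

Lemma walk_lift_step (p q : walk G) : walk_step p q ->
  walk_lift p = walk_lift q.
Proof.
case: p q => [x es H] [y es' H'] [/= xy st]; rewrite /walk_lift /= -xy.
case: st H {H' xy} => {es es' y} [l s t u r p|l z r] H.
  elim: l x H => [|e l IH] x /= [_ H]; last by rewrite a_tgt IH.
  have [st _ ut] := gprod_typed p; have [_ Hr] := H.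
  have [sr _] := composite_ends (chain_lift Hr).
  by rewrite !a_tgt ut (a_prod p) mcompA ?a_tgt ?a_src ?st ?sr.
elim: l x H => [|e l IH] x /= [ex H]; last by rewrite a_tgt IH.
have [] := composite_ends (chain_lift H).
rewrite -ex gsrc_one gtgt_one a_one tgt_idm => sr _.
by rewrite -{1}sr mcomp1l.
Qed.

Lemma walk_lift_eq p q : walk_eq p q -> walk_lift p = walk_lift q.
Proof.
by elim=> [{}p {}q /walk_lift_step|//|{}p {}q _ ->|{}p r {}q _ -> _ ->].
Qed.

Definition free_lift_mor (c : mor (free_category G)) : mor B :=
  walk_lift (rep c).

Lemma free_lift_class p : free_lift_mor (class p) = walk_lift p.
Proof. exact/walk_lift_eq/rep_class. Qed.

Lemma free_lift_id x : free_lift_mor (idm x) = idm (v x).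
Proof. by rewrite /= free_lift_class. Qed.

Lemma free_lift_comp (c d : mor (free_category G)) : tgt c = src d ->
  free_lift_mor (c ;; d) = free_lift_mor c ;; free_lift_mor d.
Proof. by move=> cd; rewrite /= free_lift_class walk_lift_cat. Qed.

Definition free_lift : functor (free_category G) B :=
  @Functor (free_category G) B v free_lift_mor
    (fun c => walk_lift_src (rep c)) (fun c => walk_lift_tgt (rep c))
    free_lift_id free_lift_comp.

Lemma free_lift_edge e : fmor free_lift (free_edge e) = a e.
Proof.
by rewrite /= free_lift_class /walk_lift /= mcomp1r.
Qed.

End FreeLift.

(** * The divided category is the category of ladders *)

Section DividedCategory.
Variables (C : category) (phi : functor C C) (Delta : ob C -> mor C).
Variables (m : nat) (hm : 0 < m).
Hypothesis gar : is_garside phi Delta.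
Local Notation ldiv := (@left_div C).
Local Notation rdiv := (@right_div C).
Local Notation from x := (fun f : mor C => src f = x).
Local Notation into x := (fun f : mor C => tgt f = x).
Local Notation "s .[ k ]" := (ext (fmor phi) hm s k).
Local Notation D := (D Delta hm).
Local Coercion Dseq : Defs.D >-> tuple_of.
Local Notation edge := (sedge phi Delta hm).
Local Coercion seseq : sedge >-> tuple_of.
Local Notation Cm := (divided_category hm gar).
Local Notation G := (divided_germ hm gar).
Local Notation ladder := (@ladder C phi Delta m hm).
Implicit Types (f g h : D) (s t u : m.-tuple (mor C)) (e : edge).
Implicit Types c d : mor Cm.

Lemma ladder_edge e : ladder (sesrc e) (setgt e) e.
Proof. by have [] := (is_edgeE gar _ _ _).1 (seP e). Qed.

Lemma ldiv_edge e k : ldiv e.[k] (sesrc e).[k].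
Proof. by have [] := (is_edgeE gar _ _ _).1 (seP e). Qed.

Lemma ext_comp s t u : (forall k, tgt s.[k] = src t.[k]) ->
  (forall i, tnth u i = tnth s i ;; tnth t i) ->
  forall k, u.[k] = s.[k] ;; t.[k].
Proof.
move=> st e; elim/(@ext_ind m hm) => [i|k IH]; first by rewrite !ext_ord.
by rewrite !ext_add IH fmor_comp.
Qed.

Lemma ext_sprod e1 e2 e3 k : sprod e1 e2 e3 -> e3.[k] = e1.[k] ;; e2.[k].
Proof.
move=> [e12 _ _ H]; apply: ext_comp => // {}k.
have [_ -> _] := ladder_edge e1 k; have [-> _ _] := ladder_edge e2 k.
by rewrite e12.
Qed.

(** Only the rungs are carried by morphisms of the original category; on
    objects the functor takes the vertex at which the [k]-th rung sits. *)
Definition rung k : functor Cm C :=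
  @free_lift G C (fun f : D => src f.[k]) (fun e : edge => e.[k])
    (fun e => let: And3 se _ _ := ladder_edge e k in se)
    (fun e => let: And3 _ te _ := ladder_edge e k in te)
    (fun f => ext_one_seq phi f k)
    (fun e1 e2 e3 => @ext_sprod e1 e2 e3 k).

Lemma rung_edge k e : fmor (rung k) (@free_edge G e) = e.[k].
Proof. exact: free_lift_edge. Qed.

Lemma rung_period k c : fmor (rung (m + k)) c = fmor phi (fmor (rung k) c).
Proof.
elim/free_mor_ind: c => [f|e c ec IH].
  by rewrite !fmor_idm /= ext_add src_fmor.
have ec' : tgt (@free_edge G e) = src c by rewrite tgt_free_edge.
rewrite !fmor_comp ?IH ?rung_edge ?ext_add //.
by rewrite -rung_edge tgt_fmor src_fmor ec'.
Qed.

Definition rungs c : m.-tuple (mor C) := [tuple fmor (rung i) c | i < m].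

Lemma ext_rungs c k : (rungs c).[k] = fmor (rung k) c.
Proof.
elim/(@ext_ind m hm): k => [i|k IH]; first by rewrite ext_ord tnth_mktuple.
by rewrite ext_add rung_period IH.
Qed.

Lemma rungs_id f k : (rungs (@idm Cm f)).[k] = idm (src f.[k]).
Proof. by rewrite ext_rungs fmor_idm. Qed.

Lemma rungs_edge e k : (rungs (@free_edge G e)).[k] = e.[k].
Proof. by rewrite ext_rungs rung_edge. Qed.

Lemma rungs_comp c d k : tgt c = src d ->
  (rungs (c ;; d)).[k] = (rungs c).[k] ;; (rungs d).[k].
Proof. by move=> cd; rewrite !ext_rungs fmor_comp. Qed.

Lemma src_rungs c k : src (rungs c).[k] = src (src c : D).[k].
Proof. by rewrite ext_rungs src_fmor. Qed.

Lemma tgt_rungs c k : tgt (rungs c).[k] = src (tgt c : D).[k].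
Proof. by rewrite ext_rungs tgt_fmor. Qed.

Lemma rungs_composable c d k : tgt c = src d ->
  tgt (rungs c).[k] = src (rungs d).[k].
Proof. by move=> cd; rewrite tgt_rungs src_rungs cd. Qed.

Lemma ladder_rungs c : ladder (src c) (tgt c) (rungs c).
Proof.
elim/free_mor_ind: c => [f|e c ec IH].
  move=> k; rewrite src_idm tgt_idm !rungs_id src_idm tgt_idm mcomp1l.
  by rewrite -(D_tgt gar) mcomp1r.
have ec' : tgt (@free_edge G e) = src c by rewrite tgt_free_edge.
rewrite src_mcomp // tgt_mcomp //.
have le : ladder (src (@free_edge G e)) (src c) e.
  by rewrite -ec' src_free_edge tgt_free_edge; apply: ladder_edge.
by apply: (ladder_comp gar le IH) => k; rewrite rungs_comp // rungs_edge.
Qed.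

Lemma ladder_head f g s : ladder f g s -> exists2 e : edge, sesrc e = f &
  forall k, glb (from (src f.[k])) ldiv s.[k] f.[k] e.[k].
Proof.
move=> ls; have [x [d ld dP]] := ladder_glb gar ls (ladder_Delta gar f).
have Hd : is_edge phi Delta hm (Dseq f) (Dseq x) d.
  by apply/(is_edgeE gar); split=> // k; case: (dP k).
by exists (SEdge Hd).
Qed.

(** [t] is the greedy head of [s]. *)
Lemma ladder_head_id f g s t : ladder f g s ->
  (forall k, glb (from (src f.[k])) ldiv s.[k] f.[k] t.[k]) ->
  (forall k, is_id t.[k]) -> forall k, is_id s.[k].
Proof.
move=> ls tP tid; apply: (ladder_coprime gar ls) => k a as_ af.
have [_ _ _ H] := tP k; apply: (is_id_ldiv gar (tid k)).
by apply: H => //; apply: ldiv_src.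
Qed.

Lemma edge_quotient f g h s t u : ladder f g s -> ladder g h u ->
  (forall k, t.[k] = s.[k] ;; u.[k]) -> (forall k, ldiv t.[k] f.[k]) ->
  exists e : edge, [/\ sesrc e = g, setgt e = h & seseq e = u].
Proof.
move=> ls lu stu tf; have Hu : is_edge phi Delta hm (Dseq g) (Dseq h) u.
  apply/(is_edgeE gar); split=> // k.
  have [ss ts sq] := ls k; have [su _ _] := lu k; have [ss' _ _] := ls k.+1.
  apply/(ldiv_mul2l gar (f := s.[k])); rewrite ?ts ?su //.
  by rewrite -stu -sq; apply: ldiv_mulr; rewrite ?(D_tgt gar).
by exists (SEdge Hu).
Qed.

Lemma sprod_ext e1 e2 e3 : setgt e1 = sesrc e2 -> sesrc e3 = sesrc e1 ->
  setgt e3 = setgt e2 -> (forall k, e3.[k] = e1.[k] ;; e2.[k]) ->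
  @gprod G e1 e2 e3.
Proof.
by move=> *; split=> // i; rewrite -!(ext_ord (fmor phi) hm).
Qed.

(** Induction on words.  For a word [e ;; c] with head [t], write [t = e v].
    Then [v] divides the ladder of [c] and the source of [c], hence divides
    the head [t1] of [c], say [t1 = v r].  The three quotients are edges, so
    the relations of the germ turn [e t1] into [e v r] and then into [t r]. *)
Lemma divided_head c : exists e d, [/\ setgt e = src d,
  c = @free_edge G e ;; d &
  forall k, glb (from (src (src c : D).[k])) ldiv
    (rungs c).[k] (src c : D).[k] e.[k]].
Proof.
elim/free_mor_ind: c => [f|e c ec [t1 [c2 [tc2 cE glb1]]]].
  exists (sone gar f), (@idm Cm f); rewrite src_idm; split=> //.
    have -> : @free_edge G (sone gar f) = @idm Cm f := free_edge_one (G := G) f.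
    by have := mcomp1l (@idm Cm f); rewrite src_idm => ->.
  move=> k; rewrite rungs_id ext_one_seq; split=> //.
  - by rewrite src_idm.
  - exact: ldiv_refl.
  - by exists (f : D).[k]; rewrite tgt_idm mcomp1l.
have ec' : tgt (@free_edge G e) = src c by rewrite tgt_free_edge.
have t1c : tgt (@free_edge G t1) = src c2 by rewrite tgt_free_edge.
have t1src : sesrc t1 = setgt e.
  by move: ec; rewrite cE src_mcomp // src_free_edge.
have lall := ladder_rungs (@free_edge G e ;; c).
have ls k : (rungs (@free_edge G e ;; c)).[k] = e.[k] ;; (rungs c).[k].
  by rewrite rungs_comp // rungs_edge.
move: lall; rewrite src_mcomp // src_free_edge => lall.
have [t te tP] := ladder_head lall; rewrite /= in te tP.
have eok k : tgt e.[k] = src (rungs c).[k].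
  by rewrite -rungs_edge; apply: rungs_composable.
have lt := ladder_edge t; rewrite te in lt.
have [|v lv vP] := ladder_ldiv gar (ladder_edge e) lt.
  move=> k; have [_ _ _] := tP k; apply.
  - by have [] := ladder_edge e k.
  - by rewrite ls; apply: ldiv_mulr => //; apply: ldiv_refl.
  - exact: ldiv_edge.
have [v' [vs vt vseq]] := edge_quotient (ladder_edge e) lv vP
  (fun k => let: And4 _ _ tf _ := tP k in tf).
subst v.
have [||r lr rP] := ladder_ldiv gar (g := setgt t) (h := setgt t1) (s := v')
    (t := t1) lv.
- by rewrite -t1src; apply: ladder_edge.
- move=> k; have [_ _ _] := glb1 k; rewrite -ec => H; apply: H.
  + by have [] := lv k.
  + have [ss _ _] := lv k; have [_ ts _] := ladder_edge e k.
    apply/(ldiv_mul2l gar (f := e.[k])); rewrite ?ss ?ts //.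
      by rewrite -eok ts.
    by rewrite -vP -ls; case: (tP k).
  + by have := ldiv_edge v' k; rewrite vs.
have [|r' [rs rt rseq]] := edge_quotient lv lr rP.
  by move=> k; rewrite -t1src; apply: ldiv_edge.
subst r; exists t, (@free_edge G r' ;; c2).
have p1 : @gprod G e v' t by apply: sprod_ext; rewrite ?vs ?vt.
have p2 : @gprod G v' r' t1 by apply: sprod_ext; rewrite ?vs ?vt ?rs ?rt.
have r'c2 : tgt (@free_edge G r') = src c2 by rewrite tgt_free_edge /= rt.
have v'r' : tgt (@free_edge G v') = src (@free_edge G r').
  by rewrite tgt_free_edge src_free_edge /= vt rs.
have ev' : tgt (@free_edge G e) = src (@free_edge G v').
  by rewrite tgt_free_edge src_free_edge /= vs.
split.
- by rewrite src_mcomp // src_free_edge /= rs.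
- rewrite cE -(free_edge_prod p2) -(free_edge_prod p1).
  by rewrite -!mcompA ?src_mcomp.
- exact: tP.
Qed.

(** An edge with trivial rungs is an identity edge, because source and rungs
    determine its target. *)
Lemma is_id_rungs c : (forall k, is_id (rungs c).[k]) <-> is_id c.
Proof.
split=> [|->]; last by move=> k; rewrite rungs_id /is_id src_idm.
elim/free_mor_ind: c => [f _|e c ec IH H]; first by rewrite /is_id src_idm.
have ec' : tgt (@free_edge G e) = src c by rewrite tgt_free_edge.
have He k : (e : edge).[k] = idm (src (sesrc e : D).[k]).
  have [<- _ _] := ladder_edge e k.
  apply: (is_id_ldiv gar) (H k) _; rewrite rungs_comp // rungs_edge.
  apply: ldiv_mulr; last exact: ldiv_refl.
  by rewrite -rungs_edge; apply: rungs_composable.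
have es : seseq e = seseq (sone gar (sesrc e)).
  by apply: (eq_ext (phi := phi) (hm := hm)) => k; rewrite He ext_one_seq.
have e1 : e = sone gar (sesrc e).
  apply: sedge_inj => //=; apply: (ladder_unique_target gar (ladder_edge e)).
  by rewrite es; apply: (ladder_edge (sone gar (sesrc e))).
have ide : @free_edge G e = idm (src c).
  rewrite -ec /= {1}e1.
  have -> : setgt e = sesrc e by rewrite e1.
  exact: free_edge_one.
rewrite ide mcomp1l; apply: IH => k; have := H k.
by rewrite ide mcomp1l.
Qed.

Lemma tuple_length : exists N : m.-tuple (mor C) -> nat,
  (forall s t u, (forall k, tgt s.[k] = src t.[k]) ->
     (forall k, u.[k] = s.[k] ;; t.[k]) -> N u = N s + N t) /\
  (forall s, N s = 0 <-> forall k, is_id s.[k]).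
Proof.
have [l [lM l0]] := gar_homogeneous gar.
exists (fun s => \sum_(i < m) l s.[i]); split=> [s t u st e|s].
  by rewrite -big_split; apply: eq_bigr => i _; rewrite e lM.
split=> [/eqP|H]; last by apply: big1 => i _; apply/l0.
rewrite sum_nat_eq0 => /forallP H; elim/(@ext_ind m hm) => [i|k IH].
  exact/l0/eqP/(implyP (H i)).
by rewrite ext_add IH /is_id fmor_idm src_idm.
Qed.

Lemma divided_homogeneous : homogeneous Cm.
Proof.
have [N [NM N0]] := tuple_length; exists (fun c => N (rungs c)); split.
  move=> c d cd; apply: NM => k; first exact: rungs_composable.
  exact: rungs_comp.
by move=> c; rewrite N0 is_id_rungs.
Qed.

Lemma glb_unique_ldiv x a b k k' : glb (from x) ldiv a b k ->
  glb (from x) ldiv a b k' -> k = k'.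
Proof.
move=> [Pk ka kb kP] [Pk' ka' kb' kP'].
by apply: (lat_anti (gar_lattice_src gar x)) => //; [apply: kP'|apply: kP].
Qed.

(** Cancellation of the common head shortens both morphisms, unless it is
    trivial, in which case both are identities. *)
Lemma rungs_inj c d : src c = src d -> rungs c = rungs d -> c = d.
Proof.
have [N [NM N0]] := tuple_length.
have [n] := ubnP (N (rungs c)); elim: n c d => // n IH c d.
rewrite ltnS => cn sE rE.
have [e [c' [ec' cE cP]]] := divided_head c.
have [e2 [d' [ed' dE dP]]] := divided_head d.
have ec'' : tgt (@free_edge G e) = src c' by rewrite tgt_free_edge.
have ed'' : tgt (@free_edge G e2) = src d' by rewrite tgt_free_edge.
have ee2 : e = e2.
  have ses : sesrc e = sesrc e2.
    by move: sE; rewrite cE dE !src_mcomp // !src_free_edge.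
  have seq : seseq e = seseq e2.
    apply: (eq_ext (phi := phi) (hm := hm)) => k.
    by apply: glb_unique_ldiv (cP k) _; rewrite rE sE; apply: dP.
  apply: sedge_inj => //; apply: (ladder_unique_target gar (ladder_edge e)).
  by rewrite ses seq; apply: ladder_edge.
have rc k : (rungs c).[k] = e.[k] ;; (rungs c').[k].
  by rewrite cE rungs_comp // rungs_edge.
have rd k : (rungs d).[k] = e.[k] ;; (rungs d').[k].
  by rewrite dE rungs_comp // rungs_edge ee2.
have cok k : tgt e.[k] = src (rungs c').[k].
  by rewrite -rungs_edge; apply: rungs_composable.
have dok k : tgt e.[k] = src (rungs d').[k].
  by rewrite ee2 -rungs_edge; apply: rungs_composable.
have [e0|ne0] := posnP (N e).
  have /is_id_rungs cid : forall k, is_id (rungs c).[k].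
    by apply: (ladder_head_id (ladder_rungs c) cP); apply/N0.
  have /is_id_rungs did : forall k, is_id (rungs d).[k].
    by rewrite -rE; apply/is_id_rungs.
  by rewrite cid did sE.
rewrite cE dE -ee2; congr (_ ;; _); apply: IH.
- apply: leq_trans cn; rewrite (NM e (rungs c') (rungs c)) //.
  by rewrite -addn1 addnC leq_add2r.
- by rewrite -ec' -ed' ee2.
apply: (eq_ext (phi := phi) (hm := hm)) => k.
apply: (mcompIl gar (a := e.[k])) => //; last by rewrite -rc -rd rE.
by rewrite -(tgt_mcomp (cok k)) -(tgt_mcomp (dok k)) -rc -rd rE.
Qed.

Lemma rungs_surj f g s : ladder f g s ->
  exists c, [/\ src c = f, tgt c = g & rungs c = s].
Proof.
have [N [NM N0]] := tuple_length.
have [n] := ubnP (N s); elim: n f s => // n IH f s; rewrite ltnS => sn ls.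
have [e ef eP] := ladder_head ls.
have [e0|ne0] := posnP (N e).
  have sid : forall k, is_id s.[k] by apply: (ladder_head_id ls eP); apply/N0.
  have es : rungs (@idm Cm f) = s.
    apply: (eq_ext (phi := phi) (hm := hm)) => k; rewrite rungs_id sid.
    by have [-> _ _] := ls k.
  exists (@idm Cm f); split=> //; first by rewrite src_idm.
  rewrite tgt_idm; apply: (ladder_unique_target gar _ ls); rewrite -es.
  by have := ladder_rungs (@idm Cm f); rewrite src_idm tgt_idm.
have le := ladder_edge e; rewrite ef in le.
have [|u lu uP] := ladder_ldiv gar le ls; first by move=> k; case: (eP k).
have eu k : tgt e.[k] = src u.[k].
  by have [_ -> _] := le k; have [-> _ _] := lu k.
have [|c [sc tc rc]] := IH (setgt e) u _ lu.
  apply: leq_trans sn; rewrite (NM e u s) //.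
  by rewrite -addn1 addnC leq_add2r.
have ec : tgt (@free_edge G e) = src c by rewrite tgt_free_edge sc.
exists (@free_edge G e ;; c); split.
- by rewrite src_mcomp // src_free_edge.
- by rewrite tgt_mcomp.
apply: (eq_ext (phi := phi) (hm := hm)) => k.
by rewrite rungs_comp // rungs_edge rc uP.
Qed.

Lemma divided_left_div c d : src c = src d ->
  left_div c d <-> forall k, ldiv (rungs c).[k] (rungs d).[k].
Proof.
move=> sE; split=> [[q [cq ->]] k|H].
  rewrite rungs_comp //; apply: ldiv_mulr; last exact: ldiv_refl.
  exact: rungs_composable.
have lc := ladder_rungs c; rewrite sE in lc.
have [u lu uP] := ladder_ldiv gar lc (ladder_rungs d) H.
have [q [sq tq rq]] := rungs_surj lu.
exists q; split=> //; apply: rungs_inj; first by rewrite src_mcomp.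
by apply: (eq_ext (phi := phi) (hm := hm)) => k; rewrite rungs_comp // rq.
Qed.

Lemma divided_right_div c d : tgt c = tgt d ->
  right_div c d <-> forall k, rdiv (rungs c).[k] (rungs d).[k].
Proof.
move=> tE; split=> [[q [cq ->]] k|H].
  rewrite rungs_comp //; apply: rdiv_mull; last exact: rdiv_refl.
  exact: rungs_composable.
have lc := ladder_rungs c; rewrite tE in lc.
have [u lu uP] := ladder_rdiv gar lc (ladder_rungs d) H.
have [q [sq tq rq]] := rungs_surj lu.
exists q; split=> //; apply: rungs_inj; first by rewrite src_mcomp.
by apply: (eq_ext (phi := phi) (hm := hm)) => k; rewrite rungs_comp // rq.
Qed.

(** Equal rungs and equal targets make [c] a right divisor of [d], with a
    quotient that is trivial by cancellation. *)
Lemma rungs_inj_tgt c d : tgt c = tgt d -> rungs c = rungs d -> c = d.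
Proof.
move=> tE rE; have [q' [q'c e']] : right_div c d.
  by apply/divided_right_div => // k; rewrite rE; apply: rdiv_refl.
have /is_id_rungs q'id : forall k, is_id (rungs q').[k].
  move=> k; have := rungs_comp k q'c; rewrite -e' -rE => e''.
  have q'ck := rungs_composable k q'c.
  have se : src (rungs c).[k] = src (rungs q').[k].
    by rewrite e'' src_mcomp.
  rewrite /is_id; apply: (mcompIr gar (b := (rungs c).[k])) => //.
  - by rewrite tgt_idm se.
  - by rewrite src_idm.
  by rewrite -e'' -se mcomp1l.
by move: q'c; rewrite e' q'id tgt_idm => ->; rewrite mcomp1l.
Qed.

(** * The Garside axioms *)

Lemma divided_lattice_src (f : ob Cm) :
  is_lattice (fun c : mor Cm => src c = f) (@left_div Cm).
Proof.
apply: (lattice_pointwise (Q := fun k => from (src (f : D).[k])) (leU := ldiv)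
         (ev := fun c k => (rungs c).[k])).
- by move=> k; apply: gar_lattice_src gar _.
- by move=> c k <-; apply: src_rungs.
- by move=> c d sc sd /eq_ext; apply: rungs_inj; rewrite sc sd.
- by move=> c d sc sd; apply: divided_left_div; rewrite sc sd.
- move=> c d sc sd; have lc := ladder_rungs c; have ld := ladder_rungs d.
  rewrite sc in lc; rewrite sd in ld.
  have [x [s /rungs_surj [q [sq _ rq]] sP]] := ladder_lub gar lc ld.
  by exists q; rewrite rq.
- move=> c d sc sd; have lc := ladder_rungs c; have ld := ladder_rungs d.
  rewrite sc in lc; rewrite sd in ld.
  have [x [s /rungs_surj [q [sq _ rq]] sP]] := ladder_glb gar lc ld.
  by exists q; rewrite rq.
Qed.

Lemma divided_lattice_tgt (f : ob Cm) :
  is_lattice (fun c : mor Cm => tgt c = f) (@right_div Cm).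
Proof.
apply: (lattice_pointwise (Q := fun k => into (src (f : D).[k])) (leU := rdiv)
         (ev := fun c k => (rungs c).[k])).
- by move=> k; apply: gar_lattice_tgt gar _.
- by move=> c k <-; apply: tgt_rungs.
- by move=> c d sc sd /eq_ext; apply: rungs_inj_tgt; rewrite sc sd.
- by move=> c d sc sd; apply: divided_right_div; rewrite sc sd.
- move=> c d sc sd; have lc := ladder_rungs c; have ld := ladder_rungs d.
  rewrite sc in lc; rewrite sd in ld.
  have [x [s /rungs_surj [q [_ sq rq]] sP]] := ladder_right_lub gar lc ld.
  by exists q; rewrite rq.
- move=> c d sc sd; have lc := ladder_rungs c; have ld := ladder_rungs d.
  rewrite sc in lc; rewrite sd in ld.
  have [x [s /rungs_surj [q [_ sq rq]] sP]] := ladder_right_glb gar lc ld.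
  by exists q; rewrite rq.
Qed.

Lemma divided_cancellative : cancellative Cm.
Proof.
move=> a c d b ac ad cb db e; apply: rungs_inj; first by rewrite -ac -ad.
apply: (eq_ext (phi := phi) (hm := hm)) => k.
have acb : tgt (a ;; c) = src b by rewrite tgt_mcomp.
have adb : tgt (a ;; d) = src b by rewrite tgt_mcomp.
apply: (gar_cancellative gar (a := (rungs a).[k]) (b := (rungs b).[k]));
  try exact: rungs_composable.
by rewrite -!rungs_comp // e.
Qed.

Lemma divided_atom_simple c : is_atom c ->
  is_simple (divided_phi hm gar) (divided_Delta hm gar) c.
Proof.
move=> [nid nfact]; have [e [d [ed cE cP]]] := divided_head c.
have ed' : tgt (@free_edge G e) = src d by rewrite tgt_free_edge.
have nide : ~ is_id (@free_edge G e).
  move=> /is_id_rungs H; apply: nid; apply/is_id_rungs.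
  apply: (ladder_head_id (ladder_rungs c) cP) => k.
  by have := H k; rewrite rungs_edge.
have idd : is_id d.
  by apply: contrapT => nd; apply: nfact; exists (@free_edge G e), d.
have {}cE : c = @free_edge G e by rewrite cE idd -ed' mcomp1r.
have [u lu uP] := ladder_ldiv gar (ladder_edge e)
  (ladder_Delta gar (sesrc e)) (ldiv_edge e).
have [q [sq tq rq]] := rungs_surj lu.
have cq : tgt c = src q by rewrite cE tgt_free_edge sq.
(* [u] completes the edge [e] to [Delta]. *)
exists q; split=> //; first by rewrite tq cE src_free_edge.
apply: rungs_inj; first by rewrite src_mcomp // src_free_edge.
apply: (eq_ext (phi := phi) (hm := hm)) => k.
by rewrite rungs_comp // cE rq !rungs_edge src_free_edge /= uP.
Qed.

Lemma rungs_phi c k :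
  (rungs (fmor (divided_phi hm gar) c)).[k] = (rungs c).[k.+1].
Proof.
elim/free_mor_ind: c => [f|e c ec IH].
  by rewrite fmor_idm !rungs_id /= ext_shift.
have ec' : tgt (@free_edge G e) = src c by rewrite tgt_free_edge.
rewrite fmor_comp // !rungs_comp // ?tgt_fmor ?src_fmor ?ec' // IH.
rewrite rungs_edge; congr (_ ;; _).
rewrite (@free_functor_edge G G (Dshift gar) (sshift gar)) rungs_edge.
exact: ext_shift.
Qed.

Lemma divided_natural :
  is_natural_from_id (divided_phi hm gar) (divided_Delta hm gar).
Proof.
split=> [f|f|c]; [exact: src_free_edge|exact: tgt_free_edge|].
have sD f : src (divided_Delta hm gar f) = f by apply: src_free_edge.
have tD f : tgt (divided_Delta hm gar f) = fob (divided_phi hm gar) f.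
  exact: tgt_free_edge.
apply: rungs_inj; first by rewrite !src_mcomp ?sD ?tD ?src_fmor.
apply: (eq_ext (phi := phi) (hm := hm)) => k.
rewrite !rungs_comp ?sD ?tD ?src_fmor // rungs_phi !rungs_edge /=.
by have [_ _ ->] := ladder_rungs c k.
Qed.

Lemma unshift s : exists t, forall k, t.[k.+1] = s.[k].
Proof.
(* The term before the first is the inverse image under [phi] of the last of
   [s]; uniformly in [k], of the one with index [m.-1 + k]. *)
have [k|k a aE|t tE] := equivariant_choice hm
  (phi := phi) (R := fun k a => fmor phi a = s.[m.-1 + k]).
- exact: (phi_mor_surj gar).
- by rewrite aE -addnCA ext_add.
exists t => k; apply: (phi_mor_inj gar); rewrite tE.
by rewrite addnS -addSn prednK // ext_add.
Qed.

(** As [phi] is injective, an identity between terms can be proved [m] places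
    further on, where the index is a successor. *)
Lemma ext_pred s k : s.[(m.-1 + k).+1] = fmor phi s.[k].
Proof. by rewrite -addSn prednK // ext_add. Qed.

Lemma Dshift_inj : injective (fun f => Dshift gar f).
Proof.
move=> f g e; apply: (eq_D (phi := phi)) => k; apply: (phi_mor_inj gar).
by rewrite -!ext_pred -!(ext_Dshift gar) e.
Qed.

Lemma Dshift_surj g : exists f, Dshift gar f = g.
Proof.
have [a aE] := unshift g.
have ca : composable (fun k => a.[k]).
  move=> k; apply: (phi_ob_inj gar); rewrite -tgt_fmor -src_fmor -!ext_pred.
  by rewrite !aE addnS; apply: (D_tgt gar).
suff Ha : in_D Delta hm a.
  exists (exist _ a Ha); apply: (eq_D (phi := phi)) => k.
  by rewrite ext_Dshift -aE.
apply/(in_D_segment Delta ca); apply: (phi_mor_inj gar).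
rewrite segment_phi // (phi_Delta gar) -src_fmor -ext_pred aE -(D_segment gar).
by apply: eq_segment => i; rewrite /= -ext_pred aE addn0.
Qed.

Lemma divided_phi_automorphism : is_automorphism (divided_phi hm gar).
Proof.
have injD : injective (fob (divided_phi hm gar)) by exact: Dshift_inj.
split; apply: inj_surj_bijective => //.
- exact: Dshift_surj.
- move=> c d e; have sE : src c = src d.
    by apply: injD; rewrite -!src_fmor e.
  apply: rungs_inj => //; apply: (eq_ext (phi := phi) (hm := hm)) => k.
  by apply: (phi_mor_inj gar); rewrite -!ext_pred -!rungs_phi e.
move=> d; have [f fE] := Dshift_surj (src d).
have [g gE] := Dshift_surj (tgt d); have [s sE] := unshift (rungs d).
have ls : ladder f g s.
  have shifted k : [/\ src s.[k.+1] = src f.[k.+1], tgt s.[k.+1] = src g.[k.+1]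
      & f.[k.+1] ;; s.[k.+2] = s.[k.+1] ;; g.[k.+1]].
    by have := ladder_rungs d k; rewrite -fE -gE !ext_Dshift -!sE.
  have ss k : src s.[k] = src f.[k].
    apply: (phi_ob_inj gar); rewrite -!src_fmor -!ext_pred.
    by case: (shifted (m.-1 + k)).
  move=> k; have [_ ts sq] := shifted (m.-1 + k).
  have {}ts : tgt s.[k] = src g.[k].
    by apply: (phi_ob_inj gar); rewrite -tgt_fmor -src_fmor -!ext_pred.
  split=> //.
  apply: (phi_mor_inj gar); rewrite !fmor_comp ?ss ?(D_tgt gar) // -!ext_pred.
  by rewrite addnS.
have [c [sc tc rc]] := rungs_surj ls; exists c.
apply: rungs_inj; first by rewrite src_fmor sc.
by apply: (eq_ext (phi := phi) (hm := hm)) => k; rewrite rungs_phi rc.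
Qed.

End DividedCategory.

Theorem theorem9p4 (C : category) (phi : functor C C) (Delta : ob C -> mor C)
    (gar : is_garside phi Delta) (m : nat) (hm : 0 < m) :
  is_garside (divided_phi hm gar) (divided_Delta hm gar).
Proof.
split.
- exact: divided_phi_automorphism.
- exact: divided_natural.
- exact: divided_homogeneous.
- exact: divided_cancellative.
- exact: divided_atom_simple.
- exact: divided_lattice_src.
- exact: divided_lattice_tgt.
Qed.
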